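(* Let $A$ be a nonnegative selfadjoint linear relation in the complex Hilbert space $\mathcal H$ and let $\mathcal L$ be a closed subspace of $\mathcal H$. Then the set $$\Xi(A,\mathcal L)=\{\widetilde A:\ \widetilde A \text{ is a nonnegative selfadjoint linear relation in }\mathcal H,\ \widetilde A\le A,\ \operatorname{ran}\widetilde A\subseteq\mathcal L\}$$ has a unique maximal element $A_{\mathcal L}$ (i.e. $A_{\mathcal L}\in\Xi(A,\mathcal L)$ and $\widetilde A\le A_{\mathcal L}$ for all $\widetilde A\in\Xi(A,\mathcal L)$), and $\ker A_{\mathcal L}\supseteq\mathcal L^\perp$. Moreover: (1) the linear relation $A_{\mathcal L}\upharpoonright\mathcal L$ is selfadjoint in $\mathcal L$, and $(A_{\mathcal L}\upharpoonright\mathcal L)^{-1}$ is the nonnegative selfadjoint linear relation in $\mathcal L$ associated with the closed sesquilinear form $\mathfrak c_{\mathcal L}[f,g]:=A^{-1}[f,g]$, $f,g\in\operatorname{dom}\mathfrak c_{\mathcal L}=\operatorname{ran}A^{1/2}\cap\mathcal L$; (2) $\operatorname{ran}(A_{\mathcal L})^{1/2}=\operatorname{ran}A^{1/2}\cap\mathcal L$, and $A_{\mathcal L}=0$ (the zero operator with $\operatorname{dom}A_{\mathcal L}=\mathcal H$) if and only if $\operatorname{ran}A^{1/2}\cap\mathcal L=\{0\}$; (3) if $\mathfrak C(A)$ is the Cayley transform of $A$, then $A_{\mathcal L}=\mathfrak C\big(I-(I-\mathfrak C(A))_{\mathcal L}\big)$, where $(I-\mathfrak C(A))_{\mathcal L}$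 is the shorted operator of the bounded nonnegative operator $I-\mathfrak C(A)$; (4) $A_{\mathcal L}$ is an operator (i.e. $\operatorname{mul}A_{\mathcal L}=\{0\}$) if and only if $\operatorname{mul}A\cap\mathcal L=\{0\}$; (5) $A_{\mathcal L}\in\mathbf B^+(\mathcal H)\setminus\{0\}$ if and only if the linear manifold $\mathfrak M:=\{f\in\mathcal D[A]:\ A^{1/2}f\in\mathcal L\}$ is a subspace (i.e. is closed) and $\operatorname{mul}A\cap\mathcal L=\{0\}$.
   Context: A linear relation (l.r.) in a complex Hilbert space $\mathcal H$ is a closed linear subspace $A=\{\{f,f'\}\}$ of $\mathcal H\oplus\mathcal H$; bounded operators are identified with their graphs. $\operatorname{dom}A$, $\operatorname{ran}A$ are the sets of first, resp. second, components; $\ker A=\{f:\{f,0\}\in A\}$, $\operatorname{mul}A=\{f':\{0,f'\}\in A\}$; $A^{-1}=\{\{f',f\}:\{f,f'\}\in A\}$; $A^*=\{\{g,g'\}:(f',g)=(f,g')\ \forall\{f,f'\}\in A\}$; $A$ is selfadjoint if $A=A^*$, nonnegative if $(f',f)\ge0$ for all $\{f,f'\}\in A$. ''Subspace'' means closed linear manifold. For a subspace $\mathcal L$, $A\upharpoonright\mathcal L:=\{\{f,f'\}\in A: f\in\operatorname{dom}A\cap\mathcal L\}$. A nonnegative selfadjoint l.r. decomposes as $A=\mathrm{Graph}(A_o)\oplus(\{0\}\oplus\operatorname{mul}A)$ with $A_o$ a nonnegative selfadjoint operator in $\overline{\operatorname{dom}}A=\mathcal H\ominus\operatorname{mul}A$.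 Put $A^{1/2}=\mathrm{Graph}(A_o^{1/2})\oplus(\{0\}\oplus\operatorname{mul}A)$, so $\operatorname{ran}A^{1/2}=\operatorname{ran}A_o^{1/2}\oplus\operatorname{mul}A$. Since $A^{1/2}$ is a relation, ''$A^{1/2}f\in\mathcal L$'' is read as: there is $f'\in\mathcal L$ with $\{f,f'\}\in A^{1/2}$. The closed form associated with $A$ is $A[\varphi,\psi]=(A_o^{1/2}\varphi,A_o^{1/2}\psi)$ with domain $\mathcal D[A]=\operatorname{dom}A_o^{1/2}$; $A[\varphi]:=A[\varphi,\varphi]$. This gives a bijection between nonnegative selfadjoint l.r. and closed nonnegative (not necessarily densely defined) forms. One has $\mathcal D[A^{-1}]=\operatorname{ran}A^{1/2}$. The order $A_1\ge A_2$ means $\mathcal D[A_1]\subseteq\mathcal D[A_2]$ and $A_1[\varphi]\ge A_2[\varphi]$ for all $\varphi\in\mathcal D[A_1]$. $\mathbf B^+(\mathcal H)$ is the set of bounded everywhere defined nonnegative selfadjoint operators in $\mathcal H$. For $S\in\mathbf B^+(\mathcal H)$ the shorted operator $S_{\mathcal L}$ is the maximal element (which exists, by Kreĭn) of $\{\widetilde S\in\mathbf B^+(\mathcal H):\widetilde S\le S,\ \operatorname{ran}\widetilde S\subseteq\mathcal L\}$. Cayley transform: for a nonnegative selfadjoint l.r. $A$, $\mathfrak C(A)=-I+2(I+A)^{-1}$, a selfadjoint contraction; for a selfadjoint contraction $T$, $\mathfrak C(T)=\{\{(I+T)f,(I-T)f\}:f\in\mathcal H\}$, a nonnegative selfadjoint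 l.r.; these maps are mutually inverse bijections.
   Formalization: In (5) the condition ran A^{1/2} ∩ L ≠ {0} is added to the right-hand side; without it the equivalence fails (e.g. A = 0, L = H), since then A_L = 0 although 𝔐 is closed and mul A ∩ L = {0}. *)

(* Defs.v *)
From HB Require Import structures.
From mathcomp Require Import all_boot all_order all_algebra.
From mathcomp Require Import sesquilinear complex.
From mathcomp Require Import all_classical all_reals all_analysis.

Set Implicit Arguments.
Unset Strict Implicit.
Unset Printing Implicit Defensive.

Import Order.TTheory GRing.Theory Num.Theory.
Import numFieldNormedType.Exports.

Local Open Scope classical_set_scope.
Local Open Scope ring_scope.

(* A complex Hilbert space is a complete normed space H over R[i] together with
   a positive definite hermitian form dot (linear in its first argument) such
   that `|x| ^+ 2 = dot x x; the last condition is a hypothesis wherever it is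
   needed. *)

Definition closed_subspace (R : realType) (V : normedModType R[i])
    (M : set V) : Prop :=
  submod_closed (mem M) /\ closed M.

Section LinearRelations.
Variables (R : realType) (H : completeNormedModType R[i]).
Variable dot : {dot H for @Num.conj R[i]}.

Definition orth_compl (L : set H) : set H := [set x | forall y, L y -> dot x y = 0].

Definition rel_dom (A : set (H * H)) : set H := fst @` A.
Definition rel_ran (A : set (H * H)) : set H := snd @` A.
Definition rel_ker (A : set (H * H)) : set H := [set x | A (x, 0)].
Definition rel_mul (A : set (H * H)) : set H := [set y | A (0, y)].

Definition rel_graph (f : H -> H) : set (H * H) := [set p | p.2 = f p.1].

Definition rel_add (A B : set (H * H)) : set (H * H) :=
  [set p | exists y z, [/\ A (p.1, y), B (p.1, z) & p.2 = y + z]].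
Definition rel_scale (a : R[i]) (A : set (H * H)) : set (H * H) :=
  [set (p.1, a *: p.2) | p in A].
Definition rel_sub (A B : set (H * H)) : set (H * H) :=
  rel_add A (rel_scale (-1) B).

Definition rel_restr (A : set (H * H)) (L : set H) : set (H * H) :=
  [set p | A p /\ (rel_dom A `&` L) p.1].

(* The suffix _in K means "in the Hilbert space K", for K a closed subspace of
   H and relations contained in K * K; K = setT gives the notions in H. *)
Definition adjoint_in (K : set H) (A : set (H * H)) : set (H * H) :=
  [set q | [/\ K q.1, K q.2 & forall p, A p -> dot p.2 q.1 = dot p.1 q.2]].

Definition selfadjoint_in (K : set H) (A : set (H * H)) : Prop :=
  closed_subspace A /\ A = adjoint_in K A.

Definition nonneg (A : set (H * H)) : Prop :=
  forall p, A p -> 0 <= dot p.2 p.1.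

Definition nnsa_in (K : set H) (A : set (H * H)) : Prop :=
  selfadjoint_in K A /\ nonneg A.

(* The operator summand A_o: for selfadjoint A, clos (dom A) is the orthogonal
   complement of mul A, so A_o is the part of A in clos (dom A) * clos (dom A). *)
Definition op_part (A : set (H * H)) : set (H * H) :=
  A `&` (closure (rel_dom A) `*` closure (rel_dom A)).

(* The nonnegative selfadjoint square root of a nonnegative selfadjoint
   operator T in the Hilbert space clos (dom T). *)
Definition op_sqrt (T : set (H * H)) : set (H * H) :=
  xget set0 [set B | [/\ nnsa_in (closure (rel_dom T)) B, rel_mul B = [set 0]
                       & (B \; B)%relation = T]].

(* Graph(A_o^{1/2}) + ({0} + mul A) *)
Definition rel_sqrt (A : set (H * H)) : set (H * H) :=
  [set p | exists2 m, rel_mul A m & op_sqrt (op_part A) (p.1, p.2 - m)].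

Definition form_dom (A : set (H * H)) : set H := rel_dom (op_sqrt (op_part A)).

(* The value at x of an operator given by its graph; 0 outside its domain. *)
Definition rel_app (T : set (H * H)) : H -> H :=
  fun_of_rel (fun=> 0) (fun x y => T (x, y)).

Definition form_val (A : set (H * H)) (x y : H) : R[i] :=
  dot (rel_app (op_sqrt (op_part A)) x) (rel_app (op_sqrt (op_part A)) y).

(* rel_le A B is A <= B: the larger relation has the smaller form domain. *)
Definition rel_le (A B : set (H * H)) : Prop :=
  form_dom B `<=` form_dom A /\
  forall x, form_dom B x -> form_val A x x <= form_val B x x.

Definition greatest_of (E : set (set (H * H))) (A : set (H * H)) : Prop :=
  E A /\ forall B, E B -> rel_le B A.

(* c is only meaningful on D. *)
Definition closed_nonneg_form (D : set H) (c : H -> H -> R[i]) : Prop :=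
  [/\ submod_closed (mem D),
      forall a x y z, D x -> D y -> D z -> c (a *: x + y) z = a * c x z + c y z,
      forall x y, D x -> D y -> c x y = Num.conj (c y x),
      forall x, D x -> 0 <= c x x
    & forall (u : nat -> H) (x : H), (forall n, D (u n)) -> u @ \oo --> x ->
        (forall e : R[i], 0 < e -> \forall m & n \near \oo,
           c (u m - u n) (u m - u n) < e) ->
        D x /\ forall e : R[i], 0 < e -> \forall n \near \oo,
           c (u n - x) (u n - x) < e].

Definition associated_in (K : set H) (B : set (H * H))
    (D : set H) (c : H -> H -> R[i]) : Prop :=
  [/\ nnsa_in K B, closed_nonneg_form D c, form_dom B = D
    & forall x y, D x -> D y -> form_val B x y = c x y].

(* B^+(H), bounded operators being identified with their graphs. *)
Definition Bplus : set (set (H * H)) :=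
  [set S | nnsa_in setT S /\
     exists2 T : {linear H -> H},
       (exists M : R[i], forall x, `|T x| <= M * `|x|) & S = rel_graph T].

Definition shorted (S : set (H * H)) (L : set H) : set (H * H) :=
  xget set0
    (greatest_of [set S' | [/\ Bplus S', rel_le S' S & rel_ran S' `<=` L]]).

(* - I + 2 (I + A)^{-1} *)
Definition cayley (A : set (H * H)) : set (H * H) :=
  rel_add (rel_scale (-1) (rel_graph idfun))
          (rel_scale 2 (rel_add (rel_graph idfun) A)^-1%relation).

(* {{(I + T) f, (I - T) f}}, with p = {f, T f} *)
Definition cayley_contraction (T : set (H * H)) : set (H * H) :=
  [set (p.1 + p.2, p.1 - p.2) | p in T].

Definition Xi (A : set (H * H)) (L : set H) : set (set (H * H)) :=
  [set B | [/\ nnsa_in setT B, rel_le B A & rel_ran B `<=` L]].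

(* {f in D[A] : A^{1/2} f in L} *)
Definition sqrt_preimage (A : set (H * H)) (L : set H) : set H :=
  [set x | form_dom A x /\ exists2 y, L y & rel_sqrt A (x, y)].

End LinearRelations.

(* Main.v *)
(* Nonnegative selfadjoint relations A correspond bijectively to operators X with
   0 <= X <= I via A = {(w - X w, X w)}, that is, (I + A)^{-1} = I - X. With
   C = (I - X)^{1/2} and S = X^{1/2} one has A^{1/2} = {(C h, S h)}, so the form
   of A is A[C h] = |h|^2 - |C h|^2 for h orthogonal to ker C, and A <= A' if and
   only if X <= X'. Since ran A = ran X, the maximum of Xi(A, L) is the relation of
   the shorted operator Y = S P S of X, where P is the projection onto
   M = {h : S h in L}; this is (3), and ran Y^{1/2} = S M = ran S `&` L gives (2).
   The inverse relation corresponds to I - X, and vectors of ran S `&` L have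
   minimal preimages of the same norm under Y^{1/2} and under S, which gives (1).
   Finally I - Y is invertible if and only if C is bounded below on M, that is,
   C M is closed and C is injective on M, which is (5). *)

Require Import Defs.
From HB Require Import structures.
From mathcomp Require Import all_boot all_order all_algebra.
From mathcomp Require Import sesquilinear complex.
From mathcomp Require Import all_classical all_reals all_analysis.
From mathcomp Require Import ring lra.

Set Implicit Arguments.
Unset Strict Implicit.
Unset Printing Implicit Defensive.

Import Order.TTheory GRing.Theory Num.Theory.
Import numFieldNormedType.Exports.
Local Open Scope classical_set_scope.
Local Open Scope ring_scope.

(** * Inner product and topology *)

(** [op_sqrt] and [shorted] are defined by choice, so identifying them needs uniqueness among
    arbitrary competitors and not only a candidate. For the square root this is the main obstacle: a
    competitor B is an unbounded relation that is not known to commute with anything. Writing B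
    itself as the relation of an operator D with 0 <= D <= I turns the question into algebra with
    bounded operators, and there commutation with X can be derived.

    The same parametrization stands in for spectral calculus. All that is needed of the latter is a
    square root of each operator between 0 and I, commuting with every contraction that commutes
    with the operator.

    Questions about ranges (Douglas factorization, surjectivity of operators bounded below) all go
    through one form of the Riesz lemma that also returns a norm bound. Keeping that bound is
    essential, because values of forms are computed from norms of minimal preimages. *)

Section HilbertSpace.
Variables (R : realType) (H : completeNormedModType R[i]).
Variable dot : {dot H for @Num.conj R[i]}.
Hypothesis normE : forall x : H, `|x| ^+ 2 = dot x x.

(** Real parts turn the estimates into real polynomial inequalities; [dotE] recovers the complex
    form by also pairing with ['i%C *: y]. *)
Definition rdot (x y : H) : R := complex.Re (dot x y).
Definition rnorm (x : H) : R := complex.Re `|x|.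

Local Notation "''[' x , y ]" := (rdot x y).
Local Notation N := rnorm.

Lemma dot_conj x y : dot x y = Num.conj (dot y x).
Proof. by rewrite (hermC dot x y) expr0 mul1r. Qed.

Lemma Re_conj (z : R[i]) : complex.Re (Num.conj z) = complex.Re z.
Proof. by case: z. Qed.

Lemma rdotC x y : '[x, y] = '[y, x].
Proof. by rewrite /rdot dot_conj Re_conj. Qed.

Lemma rdotDl x y z : '[x + y, z] = '[x, z] + '[y, z].
Proof. by rewrite /rdot linearDl raddfD. Qed.

Lemma rdotDr x y z : '[z, x + y] = '[z, x] + '[z, y].
Proof. by rewrite !(rdotC z) rdotDl. Qed.

Lemma rdotNl x z : '[- x, z] = - '[x, z].
Proof. by rewrite /rdot linearNl raddfN. Qed.

Lemma rdotNr x z : '[z, - x] = - '[z, x].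
Proof. by rewrite !(rdotC z) rdotNl. Qed.

Lemma rdot0l z : '[0, z] = 0.
Proof. by rewrite /rdot linear0l. Qed.

Lemma rdot0r z : '[z, 0] = 0.
Proof. by rewrite rdotC rdot0l. Qed.

Lemma dotZl (a : R[i]) x y : dot (a *: x) y = a * dot x y.
Proof. exact: linearZl_LR. Qed.

Lemma dotZr (a : R[i]) x y : dot x (a *: y) = Num.conj a * dot x y.
Proof. by rewrite dot_conj dotZl rmorphM [dot x y]dot_conj. Qed.

Lemma rdotZ (a : R[i]) x y : '[a *: x, y] = '[x, Num.conj a *: y].
Proof. by rewrite /rdot dotZl dotZr conjCK. Qed.

Lemma rdotZl (r : R) x y : '[r%:C%C *: x, y] = r * '[x, y].
Proof. by rewrite /rdot dotZl; case: (dot x y) => a b /=; rewrite mul0r subr0. Qed.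

Lemma rdotZr (r : R) x y : '[x, r%:C%C *: y] = r * '[x, y].
Proof. by rewrite rdotC rdotZl rdotC. Qed.

Lemma rdotil x y : '['i%C *: x, y] = - '[x, 'i%C *: y].
Proof.
rewrite /rdot dotZl dotZr; case: (dot x y) => a b /=.
by rewrite !mul0r !mul1r !sub0r mulN1r opprK.
Qed.

Definition rdotE := (rdotDl, rdotDr, rdotNl, rdotNr, rdotZl, rdotZr, rdot0l, rdot0r).

Lemma dotE x y : dot x y = Complex '[x, y] '[x, 'i%C *: y].
Proof.
rewrite /rdot dotZr; case: (dot x y) => a b /=.
by rewrite mul0r sub0r mulN1r opprK.
Qed.

Lemma normC x : `|x| = (N x)%:C%C.
Proof.
by rewrite /rnorm RRe_real // ger0_real.
Qed.

Lemma rnorm_ge0 x : 0 <= N x.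
Proof. by have := normr_ge0 x; rewrite normC ler0c. Qed.

Lemma rnorm2 x : N x ^+ 2 = '[x, x].
Proof.
by rewrite /rdot -normE normC expr2 /= mulr0 subr0.
Qed.

Lemma rdot_ge0 x : 0 <= '[x, x].
Proof. by rewrite -rnorm2 sqr_ge0. Qed.

Lemma rnorm_def x : N x = Num.sqrt '[x, x].
Proof. by rewrite -rnorm2 sqrtr_sqr ger0_norm ?rnorm_ge0. Qed.

Lemma rnorm0 : N 0 = 0. Proof. by rewrite /rnorm normr0. Qed.

Lemma rnorm0_eq0 x : N x = 0 -> x = 0.
Proof. by move=> h; apply/normr0_eq0; rewrite normC h. Qed.

Lemma rdot_eq0 x : '[x, x] = 0 -> x = 0.
Proof. by move=> h; apply: rnorm0_eq0; rewrite rnorm_def h sqrtr0. Qed.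

Lemma ler_rnormD x y : N (x + y) <= N x + N y.
Proof. by have := ler_normD x y; rewrite !normC -rmorphD lecR. Qed.

Lemma rnormN x : N (- x) = N x.
Proof. by rewrite /rnorm normrN. Qed.

Lemma rnormZ (r : R) x : N (r%:C%C *: x) = `|r| * N x.
Proof.
rewrite /rnorm normrZ normC normc_def /= expr0n /= addr0 sqrtr_sqr.
by rewrite !mulr0 subr0.
Qed.

Lemma rdot_inj x y : (forall z, '[x, z] = '[y, z]) -> x = y.
Proof.
by move=> h; apply/subr0_eq/rdot_eq0; rewrite rdotDl rdotNl h subrr.
Qed.

Lemma ler_rnorm x y : '[x, x] <= '[y, y] -> N x <= N y.
Proof. by rewrite !rnorm_def; exact: ler_wsqrtr. Qed.

Lemma rdot_mono x y : N x <= N y -> '[x, x] <= '[y, y].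
Proof. by rewrite -!rnorm2 => h; apply: lerXn2r => //; rewrite nnegrE rnorm_ge0. Qed.

(* The discriminant of the nonnegative polynomial r |-> a + 2 r b + r^2 c. *)
Lemma discriminant_le (a b c : R) :
  (forall r : R, 0 <= a + 2 * r * b + r ^+ 2 * c) -> b ^+ 2 <= a * c.
Proof.
move=> h; have [c0|c0] := eqVneq c 0.
  suff -> : b = 0 by rewrite c0 expr0n mulr0.
  (* For c = 0 the polynomial takes the value -1 at this point. *)
  apply/eqP; apply: contraT => b0; have := h (- (a + 1) / (2 * b)).
  rewrite c0 mulr0 addr0 -[2 * _ * b]mulrC => /=.
  have -> : b * (2 * (- (a + 1) / (2 * b))) = - (a + 1) by field.
  by lra.
have cp : 0 < c.
  rewrite lt_neqAle eq_sym c0 /=; rewrite leNgt; apply/negP => cn.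
  (* Let u = (a + 1 + 2 |b|) / c - 1. If c < 0 then u <= -1 and u c >= a + 1, so a + u^2 c < 0,
     against the sum of the values at u and -u. *)
  have h1 := h 0; have h2 := h ((a + 1 + `|b|*2) / c - 1); have h3 := h (1 - (a + 1 + `|b|*2) / c).
  set u := (a + 1 + `|b|*2) / c - 1 in h2 h3.
  have E : u * c = a + 1 + `|b|*2 - c by rewrite /u; field.
  have := ler_norm b; have := ler_norm (- b); rewrite normrN => n1 n2.
  by nra.
have := h (- b / c).
have -> : a + 2 * (- b / c) * b + (- b / c) ^+ 2 * c = (a * c - b ^+ 2) / c by field.
by rewrite pmulr_lge0 ?invr_gt0 // subr_ge0.
Qed.

Lemma complex_gt0P (e : R[i]) : 0 < e -> exists2 d : R, 0 < d & e = d%:C%C.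
Proof.
case: e => a b; rewrite ltcE /= => /andP[/eqP -> a0].
by exists a.
Qed.

Definition tends (u : nat -> H) (x : H) :=
  forall e : R, 0 < e -> exists n0, forall n, (n0 <= n)%N -> N (u n - x) < e.

Lemma tendsP (u : nat -> H) (x : H) : u @ \oo --> x <-> tends u x.
Proof.
split.
- move=> /cvgrPdist_lt h e e0.
  have e0' : (0 : R[i]) < e%:C%C by rewrite ltcR.
  have [n0 _ hn] := h _ e0'; exists n0 => n /hn /=.
  by rewrite distrC normC ltcR.
- move=> h; apply/cvgrPdist_lt => e /complex_gt0P[d d0 ->].
  have [n0 hn] := h d d0; exists n0 => // n /hn /=.
  by rewrite distrC normC ltcR.
Qed.

Definition rclos (M : set H) : set H :=
  [set x | forall e : R, 0 < e -> exists2 m, M m & N (x - m) < e].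

Lemma closureE M : closure M = rclos M.
Proof.
apply/seteqP; split => x.
- rewrite /closure /= => h e e0.
  have : nbhs x (ball x (e%:C%C : R[i])) by apply: nbhsx_ballx; rewrite ltcR.
  move=> /h [m [Mm]]; rewrite -ball_normE /= normC ltcR => hm.
  by exists m.
- move=> h B /nbhs_ballP [e /complex_gt0P[d d0 ->] hB].
  have [m Mm hm] := h d d0; exists m; split => //.
  by apply: hB; rewrite -ball_normE /= normC ltcR.
Qed.

Lemma closedE M : closed M <-> rclos M `<=` M.
Proof.
rewrite closure_id closureE; split => [<-//|h].
apply/seteqP; split => // x Mx e e0; exists x => //.
by rewrite subrr rnorm0.
Qed.

Lemma cauchy_tends (u : nat -> H) :
  (forall e : R, 0 < e -> exists n0, forall m n, (n0 <= m)%N -> (n0 <= n)%N ->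
     N (u m - u n) < e) -> exists x, tends u x.
Proof.
move=> h; have : cvg (u @ \oo).
  apply/cauchy_cvgP/cauchy_ballP => e /complex_gt0P[d d0 ->].
  have [n0 hn] := h d d0.
  pose U := [set u n | n in [set n | (n0 <= n)%N]].
  exists (U, U) => /=; first by split; exists n0 => // n /= nn; exists n.
  move=> _ [[m /= hm <-] [n /= hn' <-]]; rewrite -ball_normE /= normC ltcR.
  exact: hn.
by move=> /cvg_ex [x /tendsP]; exists x.
Qed.

Lemma exists_inv_lt (e : R) : 0 < e ->
  exists n0, forall n, (n0 <= n)%N -> n.+1%:R^-1 < e.
Proof.
move=> e0; exists (Num.bound e^-1) => n hn.
rewrite invf_plt ?posrE ?ltr0n//; apply: lt_le_trans (archi_boundP _) _.
  by rewrite invr_ge0 ltW.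
by rewrite ler_nat ltnW.
Qed.

Lemma rclos_tends M x : rclos M x -> exists2 u, (forall n, M (u n)) & tends u x.
Proof.
move=> h; have h' n : exists m, M m /\ N (x - m) < n.+1%:R^-1.
  by have [|m] := h n.+1%:R^-1; rewrite ?invr_gt0 ?ltr0n//; exists m.
have [u hu] := choice h'.
exists u => [n|e e0]; first by have [] := hu n.
have [n0 hn0] := exists_inv_lt e0; exists n0 => n /hn0; rewrite -opprB rnormN.
exact: lt_trans (hu n).2.
Qed.

Lemma tends_rclos M u x : (forall n, M (u n)) -> tends u x -> rclos M x.
Proof.
move=> Mu h e /h[n0 /(_ n0 (leqnn _))]; rewrite -opprB rnormN.
by exists (u n0).
Qed.

Lemma psd_cauchy_schwarz (T : H -> H) x y :
  linear T -> (forall x y, '[T x, y] = '[x, T y]) -> (forall x, 0 <= '[T x, x]) ->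
  '[T x, y] ^+ 2 <= '[T x, x] * '[T y, y].
Proof.
move=> lT sT pT; apply: discriminant_le => r.
have := pT (r%:C%C *: y + x); rewrite lT !rdotE.
by rewrite (sT y x) (rdotC y); lra.
Qed.

Lemma cauchy_schwarz x y : `|'[x, y]| <= N x * N y.
Proof.
rewrite -ler_sqr ?nnegrE ?mulr_ge0 ?rnorm_ge0//.
rewrite real_normK ?num_real// exprMn !rnorm2.
by apply: (psd_cauchy_schwarz (T := idfun)) => // z; exact: rdot_ge0.
Qed.

Lemma rdot_le_norm x y : '[x, y] <= N x * N y.
Proof. exact: le_trans (ler_norm _) (cauchy_schwarz x y). Qed.

(** * Riesz representation and orthogonal projections *)

Lemma tends_rdot u x y : tends u x ->
  forall e : R, 0 < e -> exists n0, forall n, (n0 <= n)%N -> `|'[u n, y] - '[x, y]| < e.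
Proof.
move=> h e e0; have c0 : 0 < N y + 1 by have := rnorm_ge0 y; lra.
have [n0 hn0] := h (e / (N y + 1)) (divr_gt0 e0 c0).
exists n0 => n /hn0; rewrite ltr_pdivlMr// => hn.
rewrite -rdotNl -rdotDl; apply: le_lt_trans (cauchy_schwarz _ _) _.
by have := rnorm_ge0 (u n - x); nra.
Qed.

Lemma tends_uniq u x y : tends u x -> tends u y -> x = y.
Proof.
move=> hx hy; apply: rdot_inj => z; apply/eqP; rewrite -subr_eq0 -normr_eq0.
rewrite eq_le normr_ge0 andbT; apply/ler_addgt0Pr => e e0; rewrite add0r.
have e2 : 0 < e / 2 by lra.
have [n1 h1] := tends_rdot z hx e2; have [n2 h2] := tends_rdot z hy e2.
have := h1 (maxn n1 n2) (leq_maxl _ _); have := h2 (maxn n1 n2) (leq_maxr _ _).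
set a := '[_ (maxn _ _), _]; move=> ha hb.
have -> : '[x, z] - '[y, z] = (a - '[y, z]) - (a - '[x, z]) by ring.
by apply: le_trans (ler_normB _ _) _; lra.
Qed.

Section Linear.
Variable T : H -> H.
Hypothesis lT : linear T.

Lemma linear_fun0 : T 0 = 0.
Proof. by have := lT (-1) 0 0; rewrite scaler0 add0r scaleN1r addrC subrr. Qed.

Lemma linear_funD x y : T (x + y) = T x + T y.
Proof. by have := lT 1 x y; rewrite !scale1r. Qed.

Lemma linear_funZ a x : T (a *: x) = a *: T x.
Proof. by have := lT a x 0; rewrite linear_fun0 !addr0. Qed.

Lemma linear_funN x : T (- x) = - T x.
Proof. by rewrite -scaleN1r linear_funZ scaleN1r. Qed.

Lemma linear_funB x y : T (x - y) = T x - T y.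
Proof. by rewrite linear_funD linear_funN. Qed.

Definition linear_funE := (linear_funD, linear_funN, linear_funZ, linear_fun0).
End Linear.


Definition subspace (M : set H) : Prop :=
  M 0 /\ forall a x y, M x -> M y -> M (a *: x + y).

(* Minimize |T y|^2 - 2 (x, y); along a minimizing sequence T y converges, by
   the parallelogram law, and the limit k satisfies (k, T y) = (x, y). *)
Lemma riesz (D : set H) (T : H -> H) (x : H) (c : R) :
  subspace D -> linear T -> 0 <= c ->
  (forall y, D y -> '[x, y] <= c * N (T y)) ->
  exists k, [/\ forall y, D y -> '[k, T y] = '[x, y], N k <= c & rclos (T @` D) k].
Proof.
move=> [D0 DD] lT c0 hc.
pose F y := N (T y) ^+ 2 - 2 * '[x, y].
have Fge y : D y -> - c ^+ 2 <= F y.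
  by move=> /hc; rewrite /F; have := sqr_ge0 (N (T y) - c); lra.
have hinf : has_inf (F @` D).
  by split; [exists (F 0), 0 | exists (- c ^+ 2) => _ [y /Fge ? <-]].
have Finf y : D y -> inf (F @` D) <= F y.
  by move=> Dy; apply: ge_inf hinf.2 _ _; exists y.
set i := inf _ in Finf.
have hy n : exists y, D y /\ F y < i + n.+1%:R^-1.
  have [|_ [y Dy <-] hy] := @inf_adherent _ _ n.+1%:R^-1 _ hinf; last by exists y.
  by rewrite invr_gt0 ltr0n.
have {hy}[y hy] := choice hy; have Dy n := (hy n).1; have {}hy n := (hy n).2.
(* Parallelogram law, with F at least i at the midpoint of y m and y n. *)
have par m n : N (T (y m) - T (y n)) ^+ 2 <= 2 * (m.+1%:R^-1 + n.+1%:R^-1).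
  have D' : D ((2^-1)%:C%C *: (y m + y n)).
    rewrite -[X in D X]addr0; apply: (DD) => //.
    by rewrite -[y m]scale1r; apply: DD.
  have := Finf _ D'; have := hy m; have := hy n.
  rewrite /F !(linear_funE lT) !rnorm2 !rdotE (rdotC (T (y n)) (T (y m))).
  by move: (n.+1%:R^-1) (m.+1%:R^-1) => a b; lra.
have [k hk] : exists k, tends (T \o y) k.
  apply: cauchy_tends => e e0.
  have [n0 hn0] := exists_inv_lt (divr_gt0 (exprn_gt0 2 e0) (ltr0n _ 4)).
  exists n0 => m n hm hn; rewrite -ltr_sqr ?nnegrE ?rnorm_ge0 ?ltW//=.
  apply: le_lt_trans (par m n) _; have := hn0 _ hm; have := hn0 _ hn.
  by move: (n.+1%:R^-1) (m.+1%:R^-1) (e ^+ 2) => a b d; lra.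
have key z : D z -> '[k, T z] = '[x, z].
  move=> Dz; apply/eqP; rewrite -subr_eq0 -sqrf_eq0 eq_le sqr_ge0 andbT.
  (* Moving y n by r z cannot take F below i; in the limit 2 r ((k, T z) - (x, z)) + r^2 |T z|^2 >=
     0. The constant term is 0, so the discriminant bound kills the linear coefficient. *)
  rewrite -[X in _ <= X](mul0r ('[T z, T z])).
  apply: discriminant_le => r; rewrite add0r.
  apply/ler_addgt0Pr => e e0.
  have [n1 h1] := exists_inv_lt (divr_gt0 e0 (ltr0n _ 2)).
  have r0 : 0 < 2 * `|r| + 1 by have := normr_ge0 r; lra.
  have [n2 h2] := tends_rdot (T z) hk (divr_gt0 (divr_gt0 e0 (ltr0n _ 2)) r0).
  set n := maxn n1 n2; have {}h1 := h1 n (leq_maxl _ _).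
  have {h2} := h2 n (leq_maxr _ _); rewrite ltr_pdivlMr// => h2.
  have := Finf _ (DD r%:C%C _ _ Dz (Dy n)); have := hy n.
  rewrite /F lT !rnorm2 !rdotE (rdotC (T z) (T (y n))).
  move: h2 => /=; set a := '[T (y n), T z]; set b := '[k, _] => h2.
  have := ler_norm (2 * r * (a - b)).
  rewrite !normrM ger0_norm//; have := normr_ge0 (a - b); have := normr_ge0 r.
  move: (n.+1%:R^-1) h1 h2 => d; rewrite expr2; lra.
have kcl : rclos (T @` D) k by apply: tends_rclos hk => n; exists (y n).
exists k; split => //.
have [k0|k0] := eqVneq (N k) 0; first by rewrite k0.
have kp : 0 < N k by rewrite lt_neqAle eq_sym k0 rnorm_ge0.
(* If T z is within delta of k, then |k|^2 <= c |k| + (c + |k|) delta; this delta makes the error e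
   |k|. *)
apply/ler_addgt0Pr => e e0; have [] := kcl (e * N k / (c + N k)).
  by rewrite divr_gt0 ?mulr_gt0//; lra.
move=> _ [z Dz <-]; rewrite ltr_pdivlMr; last by lra.
move=> hz; have h1 := hc z Dz; rewrite -key// in h1.
have h2 : '[k, k] <= '[k, T z] + N k * N (k - T z).
  have := rdot_le_norm k (k - T z); rewrite !rdotE; lra.
have h3 : N (T z) <= N k + N (k - T z).
  have := ler_rnormD k (T z - k).
  by rewrite addrC subrK -(opprB k) rnormN.
rewrite -rnorm2 in h2; rewrite -(ler_pM2l kp).
by move: (rnorm_ge0 (k - T z)) => h4; nra.
Qed.

(** Riesz applied to T' y |-> (x, y) gives k with (k, T' y) = (x, y), and adjointness reads this as
    T k = x. Range inclusions and surjectivity below are obtained from this. *)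
Lemma range_of_bound (T T' : H -> H) (x : H) (c : R) :
  linear T' -> (forall x y, '[T x, y] = '[x, T' y]) -> 0 <= c ->
  (forall y, '[x, y] <= c * N (T' y)) ->
  exists k, [/\ T k = x, N k <= c & rclos (range T') k].
Proof.
move=> lT' adj c0 hc; have [//|//|k [kT kc ki]] := @riesz setT T' x c _ lT' c0.
by exists k; split => //; apply: rdot_inj => z; rewrite adj kT.
Qed.

Definition csubspace (M : set H) : Prop := subspace M /\ rclos M `<=` M.

Lemma subspaceD M x y : subspace M -> M x -> M y -> M (x + y).
Proof. by move=> [_ h] Mx My; rewrite -[x]scale1r; apply: h. Qed.

Lemma subspaceZ M a x : subspace M -> M x -> M (a *: x).
Proof. by move=> [h0 h] Mx; rewrite -[_ *: _]addr0; apply: h. Qed.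

Lemma subspaceN M x : subspace M -> M x -> M (- x).
Proof. by move=> hM Mx; rewrite -scaleN1r; exact: subspaceZ. Qed.

Lemma subspaceB M x y : subspace M -> M x -> M y -> M (x - y).
Proof. by move=> hM Mx My; apply: subspaceD => //; exact: subspaceN. Qed.

(** Orthogonality for the real part; on a complex subspace M it is the usual one, since M is stable
    under multiplication by i. *)
Definition orthog (M : set H) : set H := [set x | forall m, M m -> '[x, m] = 0].

Lemma exists_proj M x : csubspace M -> exists2 p, M p & orthog M (x - p).
Proof.
move=> [sM cM].
have [//| |k [kx _ kM]] := riesz (x := x) sM (T := idfun) _ (rnorm_ge0 x).
  by move=> y _; exact: rdot_le_norm.
exists k; last by move=> m Mm; rewrite rdotDl rdotNl kx ?subrr.
by apply: cM => e /kM[_ [m Mm <-]]; exists m.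
Qed.

(** * Square roots of operators between 0 and I *)

Definition symmetric_fun (T : H -> H) := forall x y, '[T x, y] = '[x, T y].

Definition effect (X : H -> H) : Prop :=
  [/\ linear X, symmetric_fun X, forall x, 0 <= '[X x, x]
    & forall x, '[X x, x] <= '[x, x]].

(** Cauchy-Schwarz for the form (X ., .) at x and X x: |X x|^4 <= (X x, x) (X X x, X x) <= |x|^2 |X
    x|^2. *)
Lemma effect_norm X x : effect X -> N (X x) <= N x.
Proof.
move=> [lX sX pX cX]; have := psd_cauchy_schwarz x (X x) lX sX pX.
have := cX (X x); have := cX x; have := pX (X x); have := pX x.
rewrite -sX; set a := '[X x, X x] => pa pb ca cb h.
apply: ler_rnorm; rewrite -/a; have : 0 <= a by exact: rdot_ge0.
rewrite le_eqVlt => /predU1P[<-|a0]; first exact: rdot_ge0.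
rewrite -(ler_pM2l a0); nra.
Qed.

Lemma psd_eq0 T x : linear T -> symmetric_fun T -> (forall x, 0 <= '[T x, x]) ->
  '[T x, x] = 0 -> T x = 0.
Proof.
move=> lT sT pT h; apply: rdot_eq0.
have := psd_cauchy_schwarz x (T x) lT sT pT; rewrite h mul0r => h2.
by apply/eqP; rewrite -sqrf_eq0 eq_le h2 sqr_ge0.
Qed.

Lemma symmetric_eq0 T : linear T -> symmetric_fun T -> (forall x, '[T x, x] = 0) ->
  forall x, T x = 0.
Proof. by move=> lT sT h x; apply: psd_eq0 => // y; rewrite h. Qed.

Lemma linear_id : linear (fun x : H => x). Proof. by []. Qed.

Lemma linear_comp (T U : H -> H) : linear T -> linear U -> linear (T \o U).
Proof. by move=> lT lU a x y; rewrite /= lU lT. Qed.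

Lemma linear_sub (T U : H -> H) : linear T -> linear U -> linear (fun x => T x - U x).
Proof. by move=> lT lU a x y; rewrite lU lT scalerBr opprD addrACA. Qed.

Lemma linear_add (T U : H -> H) : linear T -> linear U -> linear (fun x => T x + U x).
Proof. by move=> lT lU a x y; rewrite lU lT scalerDr addrACA. Qed.

Lemma effectC X : effect X -> effect (fun x => x - X x).
Proof.
move=> [lX sX pX cX]; split.
- exact: linear_sub linear_id lX.
- by move=> x y; rewrite !rdotE sX.
- by move=> x; rewrite !rdotE subr_ge0.
- by move=> x; rewrite !rdotE gerBl.
Qed.

Lemma tends_le u x y (c : R) : tends u x -> (forall n, '[u n, y] <= c) -> '[x, y] <= c.
Proof.
move=> hx h; apply/ler_addgt0Pr => e e0.
have [n hn] := tends_rdot y hx e0; have := hn n (leqnn _); have := h n.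
by have := ler_norm (- ('[u n, y] - '[x, y])); rewrite normrN; lra.
Qed.

Lemma tends_eq u v x y a b : tends u x -> tends v y ->
  (forall n, '[u n, a] = '[v n, b]) -> '[x, a] = '[y, b].
Proof.
move=> hx hy h; apply/eqP; rewrite -subr_eq0 -normr_eq0.
rewrite eq_le normr_ge0 andbT; apply/ler_addgt0Pr => e e0; rewrite add0r.
have e2 : 0 < e / 2 by lra.
have [n1 h1] := tends_rdot a hx e2; have [n2 h2] := tends_rdot b hy e2.
have := h1 (maxn n1 n2) (leq_maxl _ _); have := h2 (maxn n1 n2) (leq_maxr _ _).
rewrite h; set c := '[v (maxn _ _), _]; move=> ha hb.
have -> : '[x, a] - '[y, b] = (c - '[y, b]) - (c - '[x, a]) by ring.
by apply: le_trans (ler_normB _ _) _; lra.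
Qed.

Lemma tends_contr Z u x : linear Z -> (forall x, N (Z x) <= N x) ->
  tends u x -> tends (Z \o u) (Z x).
Proof.
move=> lZ nZ h e /h[n0 hn]; exists n0 => n /hn; apply: le_lt_trans.
by rewrite /= -(linear_funB lZ).
Qed.

Lemma tendsD u v x y : tends u x -> tends v y -> tends (fun n => u n + v n) (x + y).
Proof.
move=> hu hv e e0; have e2 : 0 < e / 2 by lra.
have [n1 h1] := hu _ e2; have [n2 h2] := hv _ e2.
exists (maxn n1 n2) => n; rewrite geq_max => /andP[/h1 ? /h2 ?].
rewrite opprD addrACA; apply: le_lt_trans (ler_rnormD _ _) _; lra.
Qed.

Lemma rnormZc (a : R[i]) x : N (a *: x) = complex.Re `|a| * N x.
Proof. by rewrite /rnorm normrZ normc_def normC /= mul0r subr0. Qed.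

Lemma tendsZ a u x : tends u x -> tends (fun n => a *: u n) (a *: x).
Proof.
move=> hu e e0.
have a0 : 0 <= complex.Re `|a| by have := normr_ge0 a; rewrite normc_def ler0c.
have c0 : 0 < complex.Re `|a| + 1 by lra.
have [n0 hn] := hu _ (divr_gt0 e0 c0); exists n0 => n /hn.
rewrite -scalerBr rnormZc ltr_pdivlMr//; have := rnorm_ge0 (u n - x); nra.
Qed.

Lemma tendsS u x : tends u x -> tends (fun n => u n.+1) x.
Proof. by move=> hu e /hu[n0 hn]; exists n0 => n hn'; apply: hn; exact: leqW. Qed.

Lemma tends_cst x : tends (fun=> x) x.
Proof. by move=> e e0; exists 0%N => n _; rewrite subrr rnorm0. Qed.

Section SquareRoot.
Variable B : H -> H.
Hypothesis eB : effect B.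

(* The iteration y' = (B + y^2) / 2 converges to I - (I - B)^{1/2}; the numbers
   t_n are its values at B = 1 and dominate it in norm, term by term. *)
Fixpoint sqrt_iter n (x : H) : H :=
  if n is n'.+1 then (2^-1)%:C%C *: (B x + sqrt_iter n' (sqrt_iter n' x)) else 0.

Fixpoint sqrt_bound n : R := if n is n'.+1 then (1 + sqrt_bound n' ^+ 2) / 2 else 0.

Local Notation y := sqrt_iter.
Local Notation t := sqrt_bound.

Lemma sqrt_bound_itv n : 0 <= t n <= 1.
Proof.
elim: n => [|n /andP[h0 h1]] /=; first by rewrite lexx ler01.
by apply/andP; split; rewrite expr2; nra.
Qed.

Lemma sqrt_bound_ge0 n : 0 <= t n. Proof. by have /andP[] := sqrt_bound_itv n. Qed.

Lemma sqrt_bound_homo m n : (m <= n)%N -> t m <= t n.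
Proof.
move=> /subnK <-; elim: (n - m)%N => [//|k h]; rewrite addSn; apply: le_trans h _.
elim: (k + m)%N => [|j] /=; first by rewrite expr0n /= addr0 divr_ge0.
by have := sqrt_bound_ge0 j; have := sqrt_bound_ge0 j.+1 => /=; rewrite !expr2; nra.
Qed.

Lemma sqrt_iter_linear n : linear (y n).
Proof.
have [lB _ _ _] := eB.
elim: n => [|n h] /=; first by move=> a u v; rewrite scaler0 addr0.
move=> a u v; rewrite lB !h !scalerDr !scalerA mulrC -!addrA; congr (_ + _).
by rewrite addrCA.
Qed.

Lemma sqrt_iter_sym n : symmetric_fun (y n).
Proof.
have [_ sB _ _] := eB.
elim: n => [|n h] u v /=; first by rewrite !rdotE.
by rewrite !rdotE sB !h.
Qed.

(** The iterates are polynomials in B. *)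
Lemma sqrt_iter_comm n Z : linear Z -> (forall x, Z (B x) = B (Z x)) ->
  forall x, Z (y n x) = y n (Z x).
Proof.
move=> lZ cZ; elim: n => [|n h] x /=; first exact: linear_fun0.
by rewrite !(linear_funE lZ) cZ !h.
Qed.

Lemma sqrt_iter_norm n x : N (y n x) <= t n * N x.
Proof.
elim: n x => [|n h] x /=; first by rewrite rnorm0 mul0r.
rewrite rnormZ ger0_norm ?invr_ge0//.
apply: le_trans (ler_wpM2l _ (ler_rnormD _ _)) _; first by rewrite invr_ge0.
have := effect_norm x eB; have := h (y n x); have := h x.
have := sqrt_bound_ge0 n; rewrite expr2; nra.
Qed.

(** The iterates commute, so y_{n+2} - y_{n+1} = (y_{n+1} + y_n) (y_{n+1} - y_n) / 2; the t_n
    satisfy the same identity, which closes the induction. *)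
Lemma sqrt_iter_step n x : N (y n.+1 x - y n x) <= (t n.+1 - t n) * N x.
Proof.
elim: n x => [|n h] x.
  rewrite /= subr0 addr0 rnormZ ger0_norm ?invr_ge0//.
  by have := effect_norm x eB; rewrite expr0n /=; lra.
have cy u : y n (y n.+1 u) = y n.+1 (y n u).
  by apply: sqrt_iter_comm; [exact: sqrt_iter_linear|move=> v; rewrite -sqrt_iter_comm//; case: eB].
have lS := sqrt_iter_linear n.+1; have l0 := sqrt_iter_linear n.
set d := y n.+1 x - y n x.
have -> : y n.+2 x - y n.+1 x = (2^-1)%:C%C *: (y n.+1 d + y n d).
  rewrite /d (linear_funB lS) (linear_funB l0) cy addrA subrK.
  by rewrite -scalerBr opprD addrACA subrr add0r.
rewrite rnormZ ger0_norm ?invr_ge0//.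
apply: le_trans (ler_wpM2l _ (ler_rnormD _ _)) _; first by rewrite invr_ge0.
have := sqrt_iter_norm n.+1 d; have := sqrt_iter_norm n d; have := h x; rewrite -/d.
have := sqrt_bound_ge0 n; have := sqrt_bound_ge0 n.+1.
have -> : t n.+2 - t n.+1 = (t n.+1 + t n) * (t n.+1 - t n) / 2 by rewrite /=; field.
move: (t n) (t n.+1) => a b; nra.
Qed.

Lemma sqrt_iter_dist m n x : (n <= m)%N -> N (y m x - y n x) <= (t m - t n) * N x.
Proof.
move=> /subnK <-; elim: (m - n)%N => [|k h]; first by rewrite !subrr rnorm0 mul0r.
rewrite addSn -[y _.+1 x](subrK (y (k + n) x)) -addrA.
apply: le_trans (ler_rnormD _ _) _; have := sqrt_iter_step (k + n) x; lra.
Qed.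

Lemma sqrt_iter_cvg x : exists z, tends (y ^~ x) z.
Proof.
apply: cauchy_tends => e e0.
have c0 : 0 < N x + 1 by have := rnorm_ge0 x; lra.
have hsup : has_sup (range t).
  by split; [exists (t 0), 0%N|exists 1 => _ [n _ <-]; case/andP: (sqrt_bound_itv n)].
(* The t_n increase to their supremum, so beyond n0 they vary by less than e / (|x| + 1). *)
have [_ [n0 _ <-] hn0] := sup_adherent (divr_gt0 e0 c0) hsup.
have key m n : (n0 <= n)%N -> (n <= m)%N -> N (y m x - y n x) < e.
  move=> hn hm; apply: le_lt_trans (sqrt_iter_dist x hm) _.
  have h1 : t m <= sup (range t) by apply: (ub_le_sup hsup.2); exists m.
  have h2 := sqrt_bound_homo hn; have h3 := sqrt_bound_homo hm.
  have : (t m - t n) * (N x + 1) < e by rewrite -ltr_pdivlMr//; lra.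
  by have := rnorm_ge0 x; nra.
exists n0 => m n hm hn; have [|h] := leqP n m; first exact: key.
by rewrite -opprB rnormN; apply: key => //; exact: ltnW.
Qed.
End SquareRoot.

(** The limit z of the iteration for B = I - X satisfies z = (B + z^2) / 2, hence (I - z)^2 = I - 2
    z + z^2 = X, and S = I - z. *)
Lemma exists_sqrt X : effect X -> exists S, [/\ effect S, forall x, S (S x) = X x &
  forall Z, linear Z -> (forall x, N (Z x) <= N x) ->
    (forall x, Z (X x) = X (Z x)) -> forall x, Z (S x) = S (Z x)].
Proof.
move=> eX; set B := fun x => x - X x; have eB : effect B := effectC eX.
have [z hz] := choice (sqrt_iter_cvg eB).
have [lB sB pB cB] := eB.
have lz : linear z.
  move=> a u v; apply: tends_uniq (hz _) _.
  have := tendsD (tendsZ a (hz u)) (hz v).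
  by congr tends; apply/funext => n; rewrite sqrt_iter_linear.
have sz : symmetric_fun z.
  move=> u v; rewrite (rdotC u); apply: tends_eq (hz u) (hz v) _ => n.
  by rewrite sqrt_iter_sym// rdotC.
have nz u : N (z u) <= N u.
  have h : '[z u, z u] <= N u * N (z u).
    apply: tends_le (hz u) _ => n; apply: le_trans (rdot_le_norm _ _) _.
    rewrite ler_wpM2r ?rnorm_ge0//; apply: le_trans (sqrt_iter_norm eB _ _) _.
    by rewrite ler_piMl ?rnorm_ge0//; case/andP: (sqrt_bound_itv n).
  move: h; rewrite -rnorm2 expr2; have := rnorm_ge0 u; have := rnorm_ge0 (z u).
  by rewrite le_eqVlt => /predU1P[<- //|h0] _; rewrite ler_pM2r.
have fz u : z u = (2^-1)%:C%C *: (B u + z (z u)).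
  apply: tends_uniq (tendsS (hz u)) _ => /=.
  apply: tendsZ; apply: tendsD; first exact: tends_cst.
  move=> e e0; have e2 : 0 < e / 2 by lra.
  have [n1 h1] := hz u _ e2; have [n2 h2] := hz (z u) _ e2.
  exists (maxn n1 n2) => n; rewrite geq_max => /andP[/h1 k1 /h2 k2].
  set w := sqrt_iter _ n in k1 k2 *.
  have lw : linear w by exact: sqrt_iter_linear.
  (* Both the operator and its argument vary with n; the bound |w v| <= |v|, uniform in n, controls
     the first term. *)
  have -> : w (w u) - z (z u) = w (w u - z u) + (w (z u) - z (z u)).
    by rewrite (linear_funB lw) addrA subrK.
  apply: le_lt_trans (ler_rnormD _ _) _.
  have := sqrt_iter_norm eB n (w u - z u); have := sqrt_bound_itv n.
  have := rnorm_ge0 (w u - z u); rewrite -/(w _); nra.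
(* The fixed point equation gives 2 (z u, u) = (B u, u) + |z u|^2. *)
have zpos u : 0 <= '[z u, u].
  by rewrite fz rdotE rdotE (sz (z u)) mulr_ge0 ?invr_ge0// addr_ge0 ?rdot_ge0.
exists (fun u => u - z u); split.
- have ez : effect z.
    split => // u; apply: le_trans (rdot_le_norm _ _) _.
    by rewrite -rnorm2 expr2 ler_wpM2r ?rnorm_ge0.
  exact: effectC.
- move=> u; rewrite (linear_funB lz); apply: rdot_inj => w.
  by have := congr1 (rdot^~ w) (fz u); rewrite /B !rdotE; lra.
- move=> Z lZ nZ cZ u; rewrite (linear_funB lZ); congr (_ - _).
  apply: tends_uniq (hz (Z u)).
  have := tends_contr lZ nZ (hz u); congr tends; apply/funext => n /=.
  by apply: sqrt_iter_comm => // v; rewrite /B (linear_funB lZ) cZ.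
Qed.

(** * Orthogonal complements and projections *)

Lemma orthog_csubspace M : subspace M -> csubspace (orthog M).
Proof.
move=> sM; split.
  split=> [m _|a x y hx hy m Mm]; first by rewrite rdot0l.
  by rewrite rdotDl rdotZ hx ?hy ?addr0//; exact: subspaceZ.
move=> x /rclos_tends[u hu ux] m Mm.
by rewrite (tends_eq ux (tends_cst 0) (b := 0)) ?rdot0l// => n; rewrite hu// rdot0l.
Qed.

Lemma rclos_sub M : M `<=` rclos M.
Proof. by move=> x Mx e e0; exists x => //; rewrite subrr rnorm0. Qed.

Lemma rclos_rclos M : rclos (rclos M) `<=` rclos M.
Proof.
move=> x hx e e0; have e2 : 0 < e / 2 by lra.
have [y hy xy] := hx _ e2; have [z Mz yz] := hy _ e2; exists z => //.
have -> : x - z = (x - y) + (y - z) by rewrite addrA subrK.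
by apply: le_lt_trans (ler_rnormD _ _) _; lra.
Qed.

Lemma rclos_csubspace M : subspace M -> csubspace (rclos M).
Proof.
move=> [M0 MD]; split; last exact: rclos_rclos.
split; first exact: rclos_sub.
move=> a x y /rclos_tends[u hu ux] /rclos_tends[v hv vy].
apply: (tends_rclos (u := fun n => a *: u n + v n)) => [n|]; first exact: MD.
by apply: tendsD => //; exact: tendsZ.
Qed.

Definition proj (M : set H) (x : H) : H := xget 0 [set p | M p /\ orthog M (x - p)].

Section Proj.
Variable M : set H.
Hypothesis hM : csubspace M.

Lemma proj_in x : M (proj M x).
Proof.
suff [] : [set p | M p /\ orthog M (x - p)] (proj M x) by [].
by apply: xgetPex; have [p Mp hp] := exists_proj x hM; exists p.
Qed.

Lemma proj_orthog x : orthog M (x - proj M x).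
Proof.
suff [] : [set p | M p /\ orthog M (x - p)] (proj M x) by [].
by apply: xgetPex; have [p Mp hp] := exists_proj x hM; exists p.
Qed.

Lemma proj_uniq x p : M p -> orthog M (x - p) -> proj M x = p.
Proof.
move=> Mp hp; apply/subr0_eq/rdot_eq0.
have Md : M (proj M x - p) by apply: subspaceB hM.1 (proj_in x) Mp.
have := hp _ Md; have := proj_orthog x Md; rewrite !rdotE; lra.
Qed.

Lemma proj_id x : M x -> proj M x = x.
Proof. by move=> Mx; apply: proj_uniq => //; move=> m _; rewrite subrr rdot0l. Qed.

Lemma proj_sym : symmetric_fun (proj M).
Proof.
move=> x y; have := proj_orthog y (proj_in x); have := proj_orthog x (proj_in y).
by rewrite !rdotE (rdotC y) (rdotC (proj M y) (proj M x)); lra.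
Qed.

Lemma proj_linear : linear (proj M).
Proof.
move=> a x y; apply: proj_uniq.
  by apply: hM.1.2; exact: proj_in.
have -> : a *: x + y - (a *: proj M x + proj M y) = a *: (x - proj M x) + (y - proj M y).
  by rewrite scalerBr opprD addrACA.
by apply: (orthog_csubspace hM.1).1.2; exact: proj_orthog.
Qed.

Lemma proj_sq x : '[proj M x, x] = '[proj M x, proj M x].
Proof. by rewrite -proj_sym (proj_id (proj_in x)). Qed.

Lemma proj_effect : effect (proj M).
Proof.
split; [exact: proj_linear|exact: proj_sym|by move=> x; rewrite proj_sq rdot_ge0|].
move=> x; have := rdot_ge0 (x - proj M x); have := proj_sq x.
by rewrite !rdotE (rdotC x (proj M x)); lra.
Qed.

Lemma orthogK x : orthog (orthog M) x -> M x.
Proof.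
move=> hx; rewrite -(subrK (proj M x) x); suff -> : x - proj M x = 0.
  by rewrite add0r; exact: proj_in.
apply: rdot_eq0; rewrite {1}rdotDl rdotNl (hx _ (proj_orthog x)).
by rewrite rdotC (proj_orthog x (proj_in x)) subrr.
Qed.
End Proj.

(** With p the projection of x onto the closed range, T (x - p) = 0; both x and p are orthogonal to
    ker T, hence to x - p. *)
Lemma rclos_range_sym T : linear T -> symmetric_fun T ->
  rclos (range T) = orthog [set m | T m = 0].
Proof.
move=> lT sT; have sR : subspace (range T).
  split; first by exists 0 => //; exact: linear_fun0.
  by move=> a _ _ [x _ <-] [y _ <-]; exists (a *: x + y); rewrite ?lT.
have sK : subspace [set m | T m = 0].
  split=> [|a x y /= hx hy] /=; first exact: linear_fun0.
  by rewrite lT hx hy scaler0 addr0.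
have sub : rclos (range T) `<=` orthog [set m | T m = 0].
  move=> x /rclos_tends[u hu ux]; apply: (orthog_csubspace sK).2.
  apply: tends_rclos ux => n; have [v _ <-] := hu n => m /= Tm.
  by rewrite sT Tm rdot0r.
apply/seteqP; split => // x hx.
have cR := rclos_csubspace sR; set p := proj (rclos (range T)) x.
have hp : T (x - p) = 0.
  apply: rdot_inj => z; rewrite rdot0l sT; apply: (proj_orthog cR).
  by apply: rclos_sub; exists z.
suff -> : x = p by exact: proj_in.
apply/subr0_eq/rdot_eq0.
have := hx _ hp; have := sub _ (proj_in cR x) _ hp; rewrite -/p !rdotE.
by rewrite (rdotC p x); lra.
Qed.

(** * A chosen square root and its properties *)

Definition is_esqrt (X S : H -> H) : Prop :=
  [/\ effect S, forall x, S (S x) = X x &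
  forall Z, linear Z -> (forall x, N (Z x) <= N x) ->
    (forall x, Z (X x) = X (Z x)) -> forall x, Z (S x) = S (Z x)].

(* The junk value X is returned when X is not an effect. *)
Definition esqrt (X : H -> H) : H -> H :=
  if pselect (exists S, is_esqrt X S) is left h then sval (cid h) else X.

Section ESqrt.
Variable X : H -> H.
Hypothesis eX : effect X.

Lemma esqrtP : is_esqrt X (esqrt X).
Proof.
by rewrite /esqrt; case: pselect => [h|[]]; [case: cid|exact: exists_sqrt].
Qed.

Lemma esqrt_effect : effect (esqrt X). Proof. by case: esqrtP. Qed.

Lemma esqrtK x : esqrt X (esqrt X x) = X x. Proof. by case: esqrtP. Qed.

Lemma esqrt_comm Z x : effect Z -> (forall x, Z (X x) = X (Z x)) ->
  Z (esqrt X x) = esqrt X (Z x).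
Proof.
move=> eZ h; have [_ _ /(_ Z)] := esqrtP; apply=> //; first by case: eZ.
by move=> y; exact: effect_norm.
Qed.

Lemma rdot_esqrt x : '[esqrt X x, esqrt X x] = '[X x, x].
Proof. by have [_ s _ _] := esqrt_effect; rewrite -s esqrtK. Qed.

Lemma esqrt_eq0 x : esqrt X x = 0 <-> X x = 0.
Proof.
split=> [h|h]; first by rewrite -esqrtK h; apply: linear_fun0; case: esqrt_effect.
by apply: rdot_eq0; rewrite rdot_esqrt h rdot0l.
Qed.
End ESqrt.

(** D commutes with T^{1/2}, so (D T x, x) = (D T^{1/2} x, T^{1/2} x). *)
Lemma comm_psd_ge0 T D x : effect T -> effect D -> (forall x, D (T x) = T (D x)) ->
  0 <= '[D (T x), x].
Proof.
move=> eT eD h; have [_ s _ _] := esqrt_effect eT; have [_ _ pD _] := eD.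
by rewrite -(esqrtK eT) (esqrt_comm eT _ eD h) s.
Qed.

(** For d = (P - Q) x, (P + Q) d = (P^2 - Q^2) x = 0, so positivity gives P d = Q d = 0 and |d|^2 =
    (x, (P - Q) d) = 0. *)
Lemma psd_sqrt_uniq P Q : linear P -> linear Q -> symmetric_fun P -> symmetric_fun Q ->
  (forall x, 0 <= '[P x, x]) -> (forall x, 0 <= '[Q x, x]) ->
  (forall x, P (Q x) = Q (P x)) -> (forall x, P (P x) = Q (Q x)) ->
  forall x, P x = Q x.
Proof.
move=> lP lQ sP sQ pP pQ cPQ hPQ x; set d := P x - Q x.
have hd : P d + Q d = 0.
  rewrite /d (linear_funB lP) (linear_funB lQ) hPQ cPQ.
  by rewrite addrA subrK subrr.
have := congr1 (rdot^~ d) hd; rewrite rdot0l rdotDl => h0.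
have P0 : P d = 0 by apply: psd_eq0 => //; have := pP d; have := pQ d; lra.
have Q0 : Q d = 0 by move: hd; rewrite P0 add0r.
by apply/subr0_eq/rdot_eq0; rewrite -/d {1}/d rdotDl rdotNl sP sQ P0 Q0 rdot0r subrr.
Qed.

(** * Nonnegative selfadjoint relations *)

Lemma submod_closedP (V : normedModType R[i]) (M : set V) :
  submod_closed (mem M) <-> M 0 /\ forall a x y, M x -> M y -> M (a *: x + y).
Proof.
split=> [[h0 h]|[h0 h]].
  split; first by move: h0; rewrite inE.
  by move=> a x y Mx My; have := h a x y; rewrite !inE; exact.
by split; [rewrite inE|move=> a x y; rewrite !inE; exact: h].
Qed.

Lemma closed_subspaceP M : closed_subspace M <-> csubspace M.
Proof. by rewrite /closed_subspace submod_closedP closedE. Qed.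

Definition linear_rel (A : set (H * H)) : Prop :=
  A (0, 0) /\ forall a p q, A p -> A q -> A (a *: p + q).

(** The imaginary parts are the real parts for the pair i p, which is again in A. *)
Lemma dot_eqP (A : set (H * H)) x y : linear_rel A ->
  (forall p, A p -> dot p.2 x = dot p.1 y) <-> (forall p, A p -> '[p.2, x] = '[p.1, y]).
Proof.
move=> [A0 lA]; split=> h p Ap; first by rewrite /rdot h.
rewrite !dotE h//; congr (_ +i* _)%C; have Ai := lA 'i%C _ _ Ap A0.
by have := h _ Ai; rewrite /= !addr0 !rdotil => /oppr_inj.
Qed.

(** The working form of [nnsa_in]: real parts determine everything by complex linearity, and the
    last clause, A being its own adjoint, already forces A to be closed. *)
Lemma nnsaP (K : set H) (A : set (H * H)) : csubspace K ->
  nnsa_in dot K A <->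
  [/\ linear_rel A, forall p, A p -> K p.1 /\ K p.2,
      forall p q, A p -> A q -> '[p.2, q.1] = '[p.1, q.2],
      forall p, A p -> 0 <= '[p.2, p.1]
    & forall x y, K x -> K y -> (forall p, A p -> '[p.2, x] = '[p.1, y]) -> A (x, y)].
Proof.
move=> hK; split.
  move=> [[[/submod_closedP lA cA] Aadj] nA]; split => //.
  - by move=> p; rewrite Aadj => -[].
  - move=> p q Ap; rewrite {1}Aadj => -[_ _ h]; exact: (dot_eqP _ _ lA).1.
  - by move=> p /nA; rewrite lecE => /andP[].
  - by move=> x y Kx Ky h; rewrite Aadj; split => //=; exact/dot_eqP.
move=> [lA AK sA pA mA]; have Aadj : A = adjoint_in dot K A.
  apply/seteqP; split => [q Aq|[x y] [/= Kx Ky h]].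
    by have [? ?] := AK q Aq; split => //; apply/dot_eqP => // p Ap; exact: sA.
  by apply: mA => //; exact/dot_eqP.
split; last first.
  (* Symmetry applied to p and i p makes the imaginary part vanish. *)
  move=> p Ap; rewrite dotE lecE /= pA// andbT.
  have Ai := lA.2 'i%C _ _ Ap lA.1.
  have := sA _ _ Ap Ai; rewrite /= !addr0 => h; apply/eqP.
  have := rdotil p.1 p.2; rewrite (rdotC _ p.2) -h; lra.
split => //; split; first exact/submod_closedP.
move=> q; rewrite /closure /= => hq.
have {}hq (e : R) : 0 < e -> exists p, [/\ A p, N (q.1 - p.1) < e & N (q.2 - p.2) < e].
  move=> e0; have : nbhs q (ball q (e%:C%C : R[i])) by apply: nbhsx_ballx; rewrite ltcR.
  move=> /hq [p [Ap []]]; rewrite -!ball_normE /= !normC !ltcR => h1 h2.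
  by exists p.
have Kq1 : K q.1 by apply: hK.2 => e /hq[p [/AK[? _] ? _]]; exists p.1.
have Kq2 : K q.2 by apply: hK.2 => e /hq[p [/AK[_ ?] _ ?]]; exists p.2.
case: q hq Kq1 Kq2 => x y /= hq Kq1 Kq2; apply: mA => // p Ap.
apply/eqP; rewrite -subr_eq0 -normr_eq0 eq_le normr_ge0 andbT.
apply/ler_addgt0Pr => e e0; rewrite add0r.
have c0 : 0 < N p.1 + N p.2 + 1 by have := rnorm_ge0 p.1; have := rnorm_ge0 p.2; lra.
have [q [Aq h1 h2]] := hq _ (divr_gt0 e0 c0); have := sA _ _ Ap Aq.
move: h1 h2; rewrite !ltr_pdivlMr// => h1 h2 h.
have -> : '[p.2, x] - '[p.1, y] = '[p.2, x - q.1] - '[p.1, y - q.2].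
  by rewrite !rdotE h; ring.
apply: le_trans (ler_normB _ _) _.
have := cauchy_schwarz p.2 (x - q.1); have := cauchy_schwarz p.1 (y - q.2).
have := rnorm_ge0 p.1; have := rnorm_ge0 p.2.
have := rnorm_ge0 (x - q.1); have := rnorm_ge0 (y - q.2).
nra.
Qed.

Lemma csubspaceT : csubspace setT. Proof. by []. Qed.

(* The relation A with (I + A)^{-1} = I - X *)
Definition rel_of (X : H -> H) : set (H * H) := [set p | exists w, p = (w - X w, X w)].

(** With s = X^{1/2}, (X^2 x, x) = (X s x, s x) <= |s x|^2 = (X x, x). *)
Lemma effect_sq X x : effect X -> '[X x, X x] <= '[X x, x].
Proof.
move=> eX; have [_ _ p _] := esqrt_effect eX; have [_ _ _ c] := eX.
rewrite -(rdot_esqrt eX) -!(esqrtK eX); set s := esqrt X.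
by rewrite (rdot_esqrt eX) c.
Qed.

Lemma rel_of_nnsa X : effect X -> nnsa_in dot setT (rel_of X).
Proof.
move=> eX; have [lX sX pX cX] := eX; apply/(nnsaP _ csubspaceT); split => //.
- split; first by exists 0; rewrite (linear_fun0 lX) subr0.
  move=> a _ _ [u ->] [v ->]; exists (a *: u + v).
  by congr pair; rewrite /= lX// scalerBr opprD addrACA.
- by move=> _ _ [u ->] [v ->] /=; rewrite !rdotE sX; congr (_ - _); rewrite sX.
- by move=> _ [u ->] /=; rewrite !rdotE subr_ge0 effect_sq.
- move=> x y _ _ h; exists (x + y); suff -> : X (x + y) = y by rewrite addrK.
  apply: rdot_inj => z; have /= := h _ (ex_intro _ z erefl).
  by rewrite (sX (x + y)) (rdotC (x + y)) (rdotC y) !rdotE; lra.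
Qed.

(** The range D of I + A is everything. It is closed since |p.1| and |p.2| are at most |p.1 + p.2|
    on A; and g orthogonal to D gives (g, -g) in A, whence g = 0 by nonnegativity. X sends p.1 + p.2
    to p.2. *)
Lemma nnsa_rel_of (A : set (H * H)) : nnsa_in dot setT A ->
  exists2 X, effect X & A = rel_of X.
Proof.
move=> /(nnsaP _ csubspaceT) [lA _ sA pA mA]; have [A0 AD] := lA.
have AB p q : A p -> A q -> A (p - q).
  by move=> Ap Aq; have := AD (-1) _ _ Aq Ap; rewrite scaleN1r addrC.
have nA p : A p -> N p.1 <= N (p.1 + p.2) /\ N p.2 <= N (p.1 + p.2).
  move=> /pA h; have h1 := rdot_ge0 p.1; have h2 := rdot_ge0 p.2.
  by split; apply: ler_rnorm; rewrite !rdotE (rdotC p.1 p.2); lra.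
pose D := [set w | exists2 p, A p & w = p.1 + p.2].
have cD : csubspace D.
  split.
    split; first by exists (0, 0); rewrite ?addr0.
    move=> a _ _ [p Ap ->] [q Aq ->]; exists (a *: p + q); first exact: AD.
    by rewrite /= scalerDr addrACA.
  move=> w /rclos_tends[u hu uw].
  have [v hv] := choice (fun n => let: ex_intro2 p Ap e := hu n in
     ex_intro (fun p => A p /\ u n = p.1 + p.2) p (conj Ap e)).
  have cau (f : H * H -> H) : (forall p, A p -> N (f p) <= N (p.1 + p.2)) ->
      (forall p q, f (p - q) = f p - f q) -> exists x, tends (f \o v) x.
    move=> hf fB; apply: cauchy_tends => e e0.
    have e2 : 0 < e / 2 by lra.
    have [n0 hn] := uw _ e2; exists n0 => m n hm hn' /=; rewrite -fB.
    have [[Am um] [An un]] := (hv m, hv n).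
    apply: le_lt_trans (hf _ (AB _ _ Am An)) _; rewrite /= addrACA -opprD -um -un.
    have -> : u m - u n = (u m - w) - (u n - w) by rewrite opprB addrA subrK.
    apply: le_lt_trans (ler_rnormD _ _) _; rewrite rnormN.
    by have := hn _ hm; have := hn _ hn'; lra.
  have [x hx] := cau fst (fun p Ap => (nA p Ap).1) (fun p q => erefl).
  have [y hy] := cau snd (fun p Ap => (nA p Ap).2) (fun p q => erefl).
  exists (x, y).
    apply: mA => // p Ap; rewrite !(rdotC _ x) !(rdotC _ y).
    apply: tends_eq hx hy _ => n /=; have [An _] := hv n.
    by rewrite (rdotC _ p.2) (rdotC _ p.1); exact: sA.
  apply: tends_uniq uw _ => /=; have := tendsD hx hy.
  by congr tends; apply/funext => n /=; case: (hv n).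
have DT w : D w.
  apply: (orthogK cD) => g hg; suff -> : g = 0 by rewrite rdot0r.
  have Ag : A (g, - g).
    apply: mA => // p Ap; have := hg _ (ex_intro2 _ _ p Ap erefl).
    by rewrite !rdotE !(rdotC g); lra.
  have := pA _ Ag; have := rdot_ge0 g; rewrite /= rdotNl => h1 h2.
  by apply: rdot_eq0; lra.
have hX w : exists x, A (w - x, x).
  by have [p Ap ->] := DT w; exists p.2; rewrite addrK; case: p Ap.
have {hX}[X hX] := choice hX.
have Xu p : A p -> p.2 = X (p.1 + p.2).
  move=> Ap; set w := _ + _; have := pA _ (AB _ _ Ap (hX w)); rewrite /=.
  have -> : p.1 - (w - X w) = - (p.2 - X w).
    by apply: rdot_inj => z; rewrite /w !rdotE; ring.
  rewrite rdotNr => h; apply/subr0_eq/rdot_eq0.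
  by have := rdot_ge0 (p.2 - X w); lra.
have lX : linear X.
  move=> a u v; have := Xu _ (AD a _ _ (hX u) (hX v)); rewrite /= => ->.
  by congr X; rewrite addrACA -scalerDr !subrK.
have sX : symmetric_fun X.
  move=> u v; have := sA _ _ (hX u) (hX v); rewrite /= !rdotE; lra.
exists X.
  split => // u; first by have := pA _ (hX u); have := rdot_ge0 (X u); rewrite /= !rdotE; lra.
  have := pA _ (hX u); have := rdot_ge0 (u - X u); rewrite /= !rdotE (rdotC u (X u)); lra.
apply/seteqP; split => [p Ap|_ [w ->]]; last exact: hX.
by exists (p.1 + p.2); rewrite -Xu// addrK; case: p Ap.
Qed.

(** * Square roots of relations *)

(* The sine X^{1/2} and the cosine (I - X)^{1/2} *)
Definition sn (X : H -> H) : H -> H := esqrt X.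
Definition cs (X : H -> H) : H -> H := esqrt (fun x => x - X x).

Definition rel_half (X : H -> H) : set (H * H) := [set p | exists h, p = (cs X h, sn X h)].

Section Half.
Variable X : H -> H.
Hypothesis eX : effect X.
Local Notation S := (sn X).
Local Notation C := (cs X).

Lemma sn_effect : effect S. Proof. exact: esqrt_effect. Qed.
Lemma cs_effect : effect C. Proof. exact/esqrt_effect/effectC. Qed.
Lemma snK x : S (S x) = X x. Proof. exact: esqrtK. Qed.
Lemma csK x : C (C x) = x - X x. Proof. by rewrite /cs (esqrtK (effectC eX)). Qed.

Lemma sn_comm Z x : effect Z -> (forall x, Z (X x) = X (Z x)) -> Z (S x) = S (Z x).
Proof. exact: esqrt_comm. Qed.

Lemma cs_comm Z x : effect Z -> (forall x, Z (X x) = X (Z x)) -> Z (C x) = C (Z x).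
Proof.
move=> eZ h; apply: (esqrt_comm (effectC eX)) => // y.
by have [lZ _ _ _] := eZ; rewrite (linear_funB lZ) h.
Qed.

Lemma sncs x : S (C x) = C (S x).
Proof. by apply: cs_comm; [exact: sn_effect|move=> y; rewrite -!snK]. Qed.

Lemma cs2sn2 x : C (C x) + S (S x) = x. Proof. by rewrite csK snK subrK. Qed.

Lemma sn_lin : linear S. Proof. by case: sn_effect. Qed.
Lemma cs_lin : linear C. Proof. by case: cs_effect. Qed.
Lemma sn_sym : symmetric_fun S. Proof. by case: sn_effect. Qed.
Lemma cs_sym : symmetric_fun C. Proof. by case: cs_effect. Qed.

Lemma rdot_cs_sn x y : '[C x, C y] + '[S x, S y] = '[x, y].
Proof. by rewrite cs_sym sn_sym -rdotDr cs2sn2. Qed.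

Lemma cs_eq0 x : C x = 0 <-> X x = x.
Proof.
rewrite (esqrt_eq0 (effectC eX)); split=> [h|->]; last by rewrite subrr.
by apply/esym/subr0_eq.
Qed.

(** (S + I) (S x - x) = X x - x = 0, and S + I is injective because S >= 0. *)
Lemma sn_fix x : X x = x -> S x = x.
Proof.
have [lS _ pS _] := sn_effect => e; apply/subr0_eq/rdot_eq0; set d := S x - x.
have : S d + d = 0 by rewrite /d (linear_funB lS) snK e addrA subrK subrr.
move=> /(congr1 (rdot^~ d)); rewrite rdotDl rdot0l.
by have := pS d; have := rdot_ge0 d; lra.
Qed.

(** S x = C y characterizes the pairs (C h, S h), and C^2 + S^2 = I gives back h = C x + S y;
    [sn_recover] is the other component. *)
Lemma cs_recover x y : S x = C y -> C (C x + S y) = x.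
Proof. by move=> h; rewrite (linear_funD cs_lin) -sncs -h cs2sn2. Qed.

Lemma sn_recover x y : S x = C y -> S (C x + S y) = y.
Proof. by move=> h; rewrite (linear_funD sn_lin) sncs h cs2sn2. Qed.

Lemma rel_half_nnsa : nnsa_in dot setT (rel_half X).
Proof.
apply/(nnsaP _ csubspaceT); split => //.
- split; first by exists 0; rewrite (linear_fun0 sn_lin) (linear_fun0 cs_lin).
  by move=> a _ _ [u ->] [v ->]; exists (a *: u + v); rewrite sn_lin cs_lin.
- by move=> _ _ [u ->] [v ->] /=; rewrite sn_sym cs_sym sncs.
- move=> _ [u ->] /=; rewrite -cs_sym -sncs.
  by apply: comm_psd_ge0; [exact: cs_effect|exact: sn_effect|exact: sncs].
- move=> x y _ _ h; have e : S x = C y.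
    apply: rdot_inj => z; have /= := h _ (ex_intro _ z erefl).
    by rewrite sn_sym cs_sym !(rdotC z).
  by exists (C x + S y); rewrite cs_recover// sn_recover.
Qed.

Lemma rel_half_comp : (rel_half X \; rel_half X)%relation = rel_of X.
Proof.
apply/seteqP; split=> [[x y] [z [h /= [-> e]] [k /= [e' ->]]]|_ [w ->]].
  have e2 : S h = C k by rewrite -e e'.
  by exists (C h + S k); rewrite -csK -snK cs_recover// sn_recover.
by exists (C (S w)) => /=; [exists (C w)|exists (S w)]; rewrite ?csK ?snK ?sncs.
Qed.

Lemma nnsa_sub_eq A B : nnsa_in dot setT A -> nnsa_in dot setT B -> A `<=` B -> A = B.
Proof.
move=> /(nnsaP _ csubspaceT)[_ _ _ _ mA] /(nnsaP _ csubspaceT)[_ _ sB _ _] AB.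
apply/seteqP; split => // -[x y] Bxy; apply: mA => // p /AB Bp.
exact: sB _ _ Bp Bxy.
Qed.

(* Write B as the relation of D. Then X E = D^2 with E = (I-D)^2 + D^2, so D
   commutes with X, and S (I-D) = C D since both sides are nonnegative with the
   same square. *)
Lemma rel_half_uniq B : nnsa_in dot setT B -> (B \; B)%relation = rel_of X ->
  B = rel_half X.
Proof.
move=> hB; have [D eD eB] := nnsa_rel_of hB; rewrite eB => hBB.
have eD' := effectC eD; set D' := fun x => x - D x in eD'.
have D'E x : D' x = x - D x by [].
clearbody D'.
have [lD sD _ _] := eD; have [lD' sD' _ _] := eD'; have [lX sX _ _] := eX.
have DD' x : D (D' x) = D' (D x) by rewrite !D'E (linear_funB lD).
pose E x := D' (D' x) + D (D x).
(* Two steps along B, through the middle point D D' u = D' D u, give the pair (D'^2 u, D^2 u), whose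
   sum is E u. *)
have XE u : X (E u) = D (D u).
  have : rel_of X (D' (D' u), D (D u)).
    rewrite -hBB; exists (D (D' u)); first by exists (D' u); rewrite -D'E.
    by exists (D u); rewrite /= DD' D'E.
  by move=> [w [e1 e2]]; rewrite /E e1 e2 subrK.
have lE : linear E by apply: linear_add; exact: linear_comp.
have sE : symmetric_fun E by move=> x y; rewrite /E !rdotE !sD !sD'.
have EX u : E (X u) = D (D u).
  by apply: rdot_inj => z; rewrite sE sX XE !sD.
have E0 u : E u = 0 -> u = 0.
  move=> /(congr1 (rdot^~ u)); rewrite rdot0l /E rdotDl sD sD' => h.
  have h1 := rdot_ge0 (D u); have h2 := rdot_ge0 (D' u).
  have a1 : D u = 0 by apply: rdot_eq0; lra.
  have a2 : D' u = 0 by apply: rdot_eq0; lra.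
  by rewrite -(subrK (D u) u) -D'E a1 a2 addr0.
have ED u : E (D u) = D (E u).
  by rewrite /E (linear_funD lD) -!DD'.
(* E is injective and E D X = D E X = D^3 = E X D. *)
have cDX u : D (X u) = X (D u).
  apply/subr0_eq/E0; rewrite (linear_funB lE) EX ED EX subrr //.
have cD'X u : D' (X u) = X (D' u) by rewrite !D'E (linear_funB lX) cDX.
have SD u : D (S u) = S (D u) by exact: sn_comm.
have CD u : D (C u) = C (D u) by exact: cs_comm.
have SD' u : D' (S u) = S (D' u) by exact: sn_comm.
have CD' u : D' (C u) = C (D' u) by exact: cs_comm.
have key u : D' (S u) = D (C u).
  apply: (psd_sqrt_uniq (P := D' \o S) (Q := D \o C)) => //.
  - by apply: (linear_comp lD'); exact: sn_lin.
  - by apply: (linear_comp lD); exact: cs_lin.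
  - by move=> x y; rewrite /= sD' sn_sym SD'.
  - by move=> x y; rewrite /= sD cs_sym CD.
  - by move=> x; apply: (comm_psd_ge0 (T := S) (D := D')) => //; exact: sn_effect.
  - by move=> x; apply: (comm_psd_ge0 (T := C) (D := D)) => //; exact: cs_effect.
  - by move=> x; rewrite /= !(SD', SD, CD', CD, sncs, DD').
  (* The squares agree: D'^2 X = E X - D^2 X = D^2 (I - X). *)
  - move=> x; rewrite /= -SD' snK -CD csK.
    have -> : D' (D' (X x)) = E (X x) - D (D (X x)) by rewrite /E addrK.
    by rewrite EX !(linear_funB lD).
apply: nnsa_sub_eq rel_half_nnsa _; first by rewrite -eB.
move=> _ [w ->]; have e : S (D' w) = C (D w) by rewrite -SD' key CD.
by exists (C (D' w) + S (D w)); rewrite cs_recover// sn_recover// D'E.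
Qed.

(* The closure of the domain of rel_of X, by closure_dom_rel_of *)
Definition carrier : set H := orthog [set m | C m = 0].
Local Notation K := carrier.

Lemma ker_cs_subspace : subspace [set m | C m = 0].
Proof.
split=> [|a x y /= hx hy] /=; first exact: linear_fun0 cs_lin.
by rewrite cs_lin hx hy scaler0 addr0.
Qed.

Lemma carrier_csubspace : csubspace K.
Proof. exact: orthog_csubspace ker_cs_subspace. Qed.

Lemma cs_carrier h : K (C h).
Proof. by move=> m /= Cm; rewrite cs_sym Cm rdot0r. Qed.

Lemma sn_carrier h : K h -> K (S h).
Proof.
move=> Kh m /= Cm; rewrite sn_sym; apply: Kh => /=.
by rewrite -sncs Cm (linear_fun0 sn_lin).
Qed.

Lemma orthog_carrier m : orthog K m -> C m = 0.
Proof.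
by move=> h; apply: rdot_inj => z; rewrite rdot0l cs_sym h//; exact: cs_carrier.
Qed.

Lemma carrier_eq0 h : K h -> C h = 0 -> h = 0.
Proof. by move=> Kh Ch; apply: rdot_eq0; exact: Kh. Qed.

Lemma cs_carrierK p q : K p -> K q -> K (C p + S q).
Proof.
by move=> Kp Kq; apply: subspaceD carrier_csubspace.1 (cs_carrier _) (sn_carrier Kq).
Qed.

(** On the complement of K the operator X is the identity; this is the multivalued part of the
    relation. *)
Lemma rel_of_split w : exists k m, [/\ K k, orthog K m, X m = m & w = k + m].
Proof.
have hK := carrier_csubspace.
exists (proj K w), (w - proj K w); have hm := proj_orthog hK w.
split => //; [exact: (proj_in hK)|exact/cs_eq0/orthog_carrier|by rewrite addrC subrK].
Qed.

Definition op_half : set (H * H) := [set p | exists2 h, K h & p = (C h, S h)].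

Lemma op_half_mul : rel_mul op_half = [set 0].
Proof.
apply/seteqP; split=> [y [h Kh [/esym Ch ->]]|_ ->].
  by rewrite (carrier_eq0 Kh Ch) (linear_fun0 sn_lin).
by exists 0; rewrite ?(linear_fun0 sn_lin) ?(linear_fun0 cs_lin)//; exact: carrier_csubspace.1.1.
Qed.

Lemma op_half_nnsa : nnsa_in dot K op_half.
Proof.
have hK := carrier_csubspace; have [[K0 KD] _] := hK.
apply/(nnsaP _ hK); have /(nnsaP _ csubspaceT)[lh _ sh ph mh] := rel_half_nnsa.
have sub : op_half `<=` rel_half X by move=> _ [h _ ->]; exists h.
split.
- split; first by exists 0; rewrite ?(linear_fun0 sn_lin) ?(linear_fun0 cs_lin).
  move=> a _ _ [u Ku ->] [v Kv ->]; exists (a *: u + v); first exact: KD.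
  by rewrite sn_lin cs_lin.
- by move=> _ [h Kh ->]; split; [exact: cs_carrier|exact: sn_carrier].
- by move=> p q /sub hp /sub hq; exact: sh.
- by move=> p /sub; exact: ph.
- move=> x y Kx Ky h; have e : S x = C y.
    apply/subr0_eq/rdot_eq0; set d := S x - C y.
    have Kd : K d by apply: subspaceB hK.1 (sn_carrier Kx) (cs_carrier _).
    have /= := h _ (ex_intro2 _ _ d Kd erefl).
    by rewrite sn_sym cs_sym {3}/d !rdotE; lra.
  exists (C x + S y); first exact: cs_carrierK.
  by rewrite cs_recover// sn_recover.
Qed.

Lemma op_half_comp : (op_half \; op_half)%relation = rel_of X `&` (K `*` K).
Proof.
apply/seteqP; split=> [[x y] [z [h Kh /= [-> e]] [k Kk /= [e' ->]]]|].
  split; last by split => /=; [exact: cs_carrier|exact: sn_carrier].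
  by rewrite -rel_half_comp; exists z; [exists h; rewrite -e|exists k; rewrite e'].
move=> _ [[w ->] [/= Kp Kq]].
have Kw : K w by rewrite -(subrK (X w) w); exact: subspaceD carrier_csubspace.1 Kp Kq.
exists (C (S w)) => /=.
  by exists (C w); [exact: cs_carrier|rewrite csK -sncs].
by exists (S w); [exact: sn_carrier|rewrite snK].
Qed.
End Half.

(** * Forms *)

Section Forms.
Variable X : H -> H.
Hypothesis eX : effect X.
Local Notation S := (sn X).
Local Notation C := (cs X).
Local Notation K := (carrier X).
Local Notation A := (rel_of X).

Lemma closure_dom_rel_of : closure (rel_dom A) = K.
Proof.
have [lD sD _ _] := effectC eX.
have -> : rel_dom A = range (fun w => w - X w).
  apply/seteqP; split=> [_ [_ [w ->] <-]|_ [w _ <-]]; first by exists w.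
  by exists (w - X w, X w) => //; exists w.
rewrite closureE (rclos_range_sym lD sD) /carrier; congr orthog.
apply/seteqP; split => m /=; rewrite (cs_eq0 eX); first by move=> /subr0_eq/esym.
by move=> ->; rewrite subrr.
Qed.

Lemma op_part_rel_of : op_part A = A `&` (K `*` K).
Proof. by rewrite /op_part closure_dom_rel_of. Qed.

(** [op_sqrt] looks for roots in the closed domain of the operator part. Dropping the component of w
    in ker C does not change w - X w, so this closure is still K. *)
Lemma closure_dom_op_part : closure (rel_dom (op_part A)) = K.
Proof.
rewrite -closure_dom_rel_of; congr closure; apply/seteqP; split.
  by move=> _ [p [Ap _] <-]; exists p.
move=> _ [_ [w ->] <-]; have [k [m [Kk hm Xm ->]]] := rel_of_split eX w.
have [lX _ _ _] := eX; have hK := carrier_csubspace eX.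
have e : k + m - X (k + m) = k - X k.
  by rewrite (linear_funD lX) Xm opprD addrACA subrr addr0.
have Kd : K (k - X k) by rewrite -(csK eX); exact: cs_carrier.
exists (k - X k, X k); last by rewrite /= e.
rewrite op_part_rel_of; split; first by exists k.
by split => //=; rewrite -(snK eX); do 2 apply: (sn_carrier eX).
Qed.

(* A square root B of the operator part, in K, becomes a square root of A in the
   whole space when {0} x K^perp is added to it, and those are unique. *)
Lemma op_sqrt_rel_of : op_sqrt dot (op_part A) = op_half X.
Proof.
have hK := carrier_csubspace eX; have [sK _] := hK; have [K0 _] := sK.
have sO := (orthog_csubspace sK).1; have [lX _ _ _] := eX.
have KO z : K z -> orthog K z -> z = 0 by move=> Kz Oz; apply: rdot_eq0; exact: Oz.
rewrite /op_sqrt closure_dom_op_part op_part_rel_of.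
apply: xget_unique; first split.
- exact: op_half_nnsa.
- exact: op_half_mul.
- exact: op_half_comp.
move=> B [/(nnsaP _ hK)[lB BK sB pB mB] _ BB].
have [B0 BD] := lB.
pose B' := [set p : H * H | exists m, [/\ orthog K m, K (p.2 - m) & B (p.1, p.2 - m)]].
have nB' : nnsa_in dot setT B'.
  apply/(nnsaP _ csubspaceT); split => //.
  - split; first by exists 0; rewrite /= subr0; split => //; exact: sO.1.
    move=> a p q [m [Om _ Bp]] [n [On _ Bq]]; exists (a *: m + n).
    have e : a *: p.2 + q.2 - (a *: m + n) = a *: (p.2 - m) + (q.2 - n).
      by rewrite scalerBr opprD addrACA.
    have Bpq := BD a _ _ Bp Bq; rewrite /= e; split => //; first exact: sO.2.
    by have [] := BK _ Bpq.
  - move=> p q [m [Om _ Bp]] [n [On _ Bq]].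
    have := sB _ _ Bp Bq; have [/= Kp _] := BK _ Bp; have [/= Kq _] := BK _ Bq.
    by rewrite /= !rdotE (Om _ Kq) (rdotC p.1 n) (On _ Kp) !subr0.
  - move=> p [m [Om _ Bp]]; have := pB _ Bp; have [/= Kp _] := BK _ Bp.
    by rewrite /= !rdotE (Om _ Kp) subr0.
  - move=> x y _ _ h.
    (* Testing against the purely multivalued pairs (0, m) of B' gives x orthogonal to the
       complement of K. *)
    have Kx : K x.
      apply: (orthogK hK) => m Om; rewrite rdotC.
      have /= -> := h (0, m); rewrite ?rdot0l//.
      by exists m; rewrite /= subrr; split.
    exists (y - proj K y); rewrite /= subKr; have := proj_in hK y => Ky.
    split => //; first exact: proj_orthog.
    apply: mB => // p Bp; have [Kp1 Kp2] := BK _ Bp.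
    rewrite h; last by exists 0; rewrite subr0; split => //; [exact: sO.1|case: p Bp {Kp1 Kp2}].
    by have := proj_orthog hK y Kp1; rewrite !(rdotC p.1) !rdotE; lra.
have B'B' : (B' \; B')%relation = A.
  apply/seteqP; split.
    move=> [x y] [z [m [Om Kz' /= Bxz]] [n [On _ /= Bzy]]].
    have [/= Kz _] := BK _ Bzy.
    (* The middle point z is in K, so it has no component in the complement. *)
    have m0 : m = 0.
      apply: KO => //; rewrite -(subKr z m).
      by apply: (subspaceB sK).
    rewrite m0 subr0 in Bxz.
    have : (B \; B)%relation (x, y - n) by exists z.
    rewrite BB => -[[w [e1 e2]] _].
    have Xn : X n = n by apply/(cs_eq0 eX)/(orthog_carrier eX).
    exists (w + n); rewrite (linear_funD lX) Xn.
    by rewrite opprD addrACA subrr addr0 -e1 -e2 subrK.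
  move=> _ [w ->]; have [k [m [Kk Om Xm ->]]] := rel_of_split eX w.
  have KX : K (X k) by rewrite -(snK eX); do 2 apply: (sn_carrier eX).
  have : (B \; B)%relation (k - X k, X k).
    by rewrite BB; split; [exists k|split => //=; exact: (subspaceB sK)].
  move=> [z /= Bz Bz']; have [_ /= Kz] := BK _ Bz.
  rewrite (linear_funD lX) Xm opprD addrACA subrr addr0.
  exists z; first by exists 0; rewrite /= subr0; split => //; exact: sO.1.
  by exists m; rewrite /= addrK; split.
have eB' := rel_half_uniq eX nB' B'B'.
apply/seteqP; split => [[x y] Bxy|_ [h Kh ->]].
  have [/= Kx Ky] := BK _ Bxy.
  have : B' (x, y) by exists 0; rewrite /= subr0; split => //; exact: sO.1.
  rewrite eB' => -[h [ex ey]]; exists h; last by rewrite ex ey.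
  by rewrite -(cs2sn2 eX h) -ex -ey; exact: cs_carrierK.
have : B' (C h, S h) by rewrite eB'; exists h.
move=> [m [Om /= Km Bh]].
have m0 : m = 0.
  apply: KO => //; rewrite -(subKr (S h) m); apply: (subspaceB sK) => //.
  exact: sn_carrier.
by move: Bh; rewrite m0 subr0.
Qed.

Lemma rel_app_op_half h : K h -> rel_app (op_half X) (C h) = S h.
Proof.
move=> Kh; apply: fun_of_rel_uniq; last by exists h.
move=> y z [k Kk [e ->]] [l Kl [e' ->]]; congr S.
apply/subr0_eq/(carrier_eq0 (X := X)).
  exact: (subspaceB (carrier_csubspace eX).1).
by rewrite (linear_funB (cs_lin eX)) -e -e' subrr.
Qed.

(** The component m of h in ker C contributes (0, S m), and S m is in the multivalued part; the
    component in K gives the square root of the operator part. *)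
Lemma rel_sqrt_rel_of : rel_sqrt dot A = rel_half X.
Proof.
rewrite /rel_sqrt op_sqrt_rel_of; apply/seteqP; split=> [[x y] [m [w [ew em]] [h Kh /= [-> e]]]|].
  have Xm : X m = m by rewrite em; congr X; exact/esym/subr0_eq.
  have Cm : C m = 0 by exact/(cs_eq0 eX).
  have Sm := sn_fix eX Xm.
  exists (h + m); rewrite (linear_funD (cs_lin eX)) (linear_funD (sn_lin eX)) Cm Sm addr0.
  by rewrite -e subrK.
move=> _ [h ->]; have hK := carrier_csubspace eX.
have Om := proj_orthog hK h; set m := h - _ in Om.
have Cm := orthog_carrier eX Om; have CSm : C (S m) = 0.
  by rewrite -(sncs eX) Cm (linear_fun0 (sn_lin eX)).
exists (S m).
  exists (S m); have /(cs_eq0 eX) e := CSm.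
  by rewrite e subrr.
have -> : h = proj K h + m by rewrite addrC subrK.
exists (proj K h); first exact: (proj_in hK).
by rewrite /= (linear_funD (cs_lin eX)) (linear_funD (sn_lin eX)) Cm addr0 addrK.
Qed.

Lemma form_domP x : form_dom dot A x <-> exists2 h, K h & x = C h.
Proof.
rewrite /form_dom op_sqrt_rel_of; split => [[_ [h Kh ->] <-]|[h Kh ->]].
  by exists h.
by exists (C h, S h) => //; exists h.
Qed.

Lemma form_dom_range : form_dom dot A = range C.
Proof.
apply/seteqP; split => x; first by move=> /form_domP[h _ ->]; exists h.
move=> [h _ <-]; apply/form_domP; have hK := carrier_csubspace eX.
exists (proj K h); first exact: (proj_in hK).
apply/subr0_eq; rewrite -(linear_funB (cs_lin eX)).
exact/(orthog_carrier eX)/(proj_orthog hK).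
Qed.

Lemma form_valE h k : K h -> K k -> form_val dot A (C h) (C k) = dot (S h) (S k).
Proof. by move=> Kh Kk; rewrite /form_val op_sqrt_rel_of !rel_app_op_half. Qed.

Lemma rel_ran_sqrt : rel_ran (rel_sqrt dot A) = range S.
Proof.
rewrite rel_sqrt_rel_of; apply/seteqP; split=> [_ [_ [h ->] <-]|_ [h _ <-]].
  by exists h.
by exists (C h, S h) => //; exists h.
Qed.
End Forms.

(** * The shorted operator *)

Lemma dotxx x : dot x x = ('[x, x])%:C%C.
Proof. by rewrite -normE normC -rnorm2 rmorphXn. Qed.

Lemma le_dotxx x y : (dot x x <= dot y y) = ('[x, x] <= '[y, y]).
Proof. by rewrite !dotxx lecR. Qed.

(** k - h is in ker C and h is orthogonal to it: preimages in the carrier are the ones of least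
    norm. *)
Lemma carrier_min X h k : effect X -> carrier X h -> cs X h = cs X k -> '[h, h] <= '[k, k].
Proof.
move=> eX Kh e; have : '[h, k - h] = 0.
  by apply: Kh; rewrite /= (linear_funB (cs_lin eX)) e subrr.
by have := rdot_ge0 (k - h); rewrite !rdotE (rdotC k h); lra.
Qed.

(* Douglas' lemma for the nonnegative square roots of I - X and I - Y *)
Lemma rel_leP X Y : effect X -> effect Y ->
  rel_le dot (rel_of X) (rel_of Y) <-> forall w, '[X w, w] <= '[Y w, w].
Proof.
move=> eX eY.
have cE Z w : effect Z -> '[cs Z w, cs Z w] = '[w, w] - '[Z w, w].
  by move=> eZ; rewrite rdot_esqrt ?rdotE//; exact: effectC.
split=> [[hd hv] w|h].
  (* The forms are compared at C_Y h = C_X k, with h = C_Y w. This gives |k| <= |h|, and |h|^2 = (w,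
     C_Y h) = (C_X w, k) then yields |h| <= |C_X w|. *)
  have Kh := cs_carrier eY w; set h := cs Y w in Kh.
  have dY : form_dom dot (rel_of Y) (cs Y h) by apply/form_domP => //; exists h.
  have := hd _ dY => /form_domP - /(_ eX)[k Kk e].
  have := hv _ dY; rewrite form_valE// e form_valE// le_dotxx => hkh.
  have h1 := rdot_cs_sn eX k k; have h2 := rdot_cs_sn eY h h; rewrite e in h2.
  have nkh : N k <= N h by apply: ler_rnorm; lra.
  suff : N h <= N (cs X w).
    by move=> /rdot_mono; rewrite !cE//; lra.
  have : '[h, h] <= N h * N (cs X w).
    have -> : '[h, h] = '[cs X w, k] by rewrite (cs_sym eX) -e {1}/h (cs_sym eY).
    apply: le_trans (rdot_le_norm _ _) _.
    by rewrite mulrC ler_wpM2r ?rnorm_ge0.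
  rewrite -rnorm2 expr2; have := rnorm_ge0 h.
  by rewrite le_eqVlt => /predU1P[<-|h0]; rewrite ?rnorm_ge0// ler_pM2l.
(* Since |C_Y y| <= |C_X y|, the functional (C_Y k, y) is at most |k| |C_X y|. *)
have main x k : x = cs Y k -> exists k', cs X k' = x /\ N k' <= N k.
  move=> ->.
  have [||||k' [e n _]] := @range_of_bound (cs X) (cs X) (cs Y k) (N k).
  - exact: cs_lin.
  - exact: cs_sym.
  - exact: rnorm_ge0.
  - move=> y; rewrite cs_sym//; apply: le_trans (rdot_le_norm _ _) _.
    rewrite ler_wpM2l ?rnorm_ge0//; apply: ler_rnorm; rewrite !cE//.
    by have := h y; lra.
  by exists k'.
split=> x /form_domP - /(_ eY)[k Kk e]; have [k' [e' n]] := main _ _ e.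
  by rewrite form_dom_range//; exists k'.
have /form_domP - /(_ eX)[l Kl e2] : form_dom dot (rel_of X) x.
  by rewrite form_dom_range//; exists k'.
rewrite {1 2}e2 e !form_valE// le_dotxx.
have hmin : '[l, l] <= '[k', k'] by apply: carrier_min Kl _ => //; rewrite -e2.
have := rdot_cs_sn eX l l; have := rdot_cs_sn eY k k; rewrite -e -e2.
by have := rdot_mono n; lra.
Qed.

Lemma effect_ext X Y : effect X -> effect Y -> (forall w, '[X w, w] = '[Y w, w]) ->
  forall w, X w = Y w.
Proof.
move=> [lX sX _ _] [lY sY _ _] h w; apply/subr0_eq.
apply: (symmetric_eq0 (T := fun w => X w - Y w)) => [|x y|x].
- exact: linear_sub.
- by rewrite !rdotE sX sY.
- by rewrite !rdotE h subrr.
Qed.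

Section Short.
Variables (X : H -> H) (L : set H).
Hypotheses (eX : effect X) (hL : csubspace L).
Local Notation S := (sn X).
Local Notation C := (cs X).

Definition pre_short : set H := [set h | L (S h)].
Local Notation M := pre_short.
Local Notation P := (proj M).

(* Krein's formula for the shorted operator *)
Definition short (x : H) : H := S (P (S x)).
Local Notation Y := short.

Lemma pre_short_csubspace : csubspace M.
Proof.
have [[L0 LD] cL] := hL; have lS := sn_lin eX; split.
  split=> [|a x y Mx My]; rewrite /M /= ?(linear_fun0 lS)//.
  by rewrite lS; exact: LD.
move=> x /rclos_tends[u hu ux]; apply: cL.
apply: tends_rclos (tends_contr lS _ ux); first exact: hu.
by move=> y; apply: effect_norm; exact: sn_effect.
Qed.
Local Notation hM := pre_short_csubspace.

Lemma rdot_short x y : '[Y x, y] = '[P (S x), P (S y)].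
Proof. by rewrite /Y (sn_sym eX) -(proj_sym hM) (proj_id hM (proj_in hM _)). Qed.

Lemma short_effect : effect Y.
Proof.
have lS := sn_lin eX; have [lP _ _ cP] := proj_effect hM; split.
- by move=> a x y; rewrite /Y lS lP lS.
- by move=> x y; rewrite rdot_short (rdotC x) rdot_short rdotC.
- by move=> x; rewrite rdot_short rdot_ge0.
- move=> x; rewrite rdot_short -(proj_sq hM); apply: le_trans (cP _) _.
  by rewrite (sn_sym eX) -(sn_sym eX) rdot_esqrt//; have [_ _ _] := eX.
Qed.

Lemma short_le w : '[Y w, w] <= '[X w, w].
Proof.
rewrite rdot_short -(proj_sq hM); have [_ _ _ cP] := proj_effect hM.
by apply: le_trans (cP _) _; rewrite rdot_esqrt.
Qed.

Lemma short_in w : L (Y w).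
Proof. exact: proj_in hM (S w). Qed.

Lemma short_orthog w : orthog L w -> Y w = 0.
Proof.
move=> Ow; have [lY sY pY _] := short_effect; apply: psd_eq0 => //.
by rewrite rdotC (Ow _ (short_in w)).
Qed.

(** M is the complement of S (L^perp), because S is symmetric and L is closed; taking complements
    again gives the closure. *)
Lemma orthog_pre_short : orthog M `<=` rclos (S @` orthog L).
Proof.
have lS := sn_lin eX; have sO := (orthog_csubspace hL.1).1.
have cQ : csubspace (rclos (S @` orthog L)).
  apply: rclos_csubspace; split; first by exists 0; [exact: sO.1|exact: linear_fun0].
  move=> a _ _ [u Ou <-] [v Ov <-]; exists (a *: u + v); last by rewrite lS.
  exact: sO.2.
move=> x Ox; apply: (orthogK cQ) => g Og; apply: Ox; apply: (orthogK hL) => l Ol.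
by rewrite (sn_sym eX) Og//; apply: rclos_sub; exists l.
Qed.

(* S w - P S w is a limit of vectors S l with l orthogonal to L, and
   (Z w, w) = (Z (w - l), w - l) for such l. *)
Lemma short_max Z (c : R) : linear Z -> symmetric_fun Z -> 0 <= c ->
  (forall w, '[Z w, w] <= c * '[X w, w]) -> (forall w, L (Z w)) ->
  forall w, '[Z w, w] <= c * '[Y w, w].
Proof.
move=> lZ sZ c0 hZ LZ w.
have Z0 l : orthog L l -> Z l = 0.
  by move=> Ol; apply: rdot_inj => z; rewrite rdot0l sZ Ol.
have le l : orthog L l -> '[Z w, w] <= c * N (S (w - l)) ^+ 2.
  move=> Ol; have := hZ (w - l); rewrite -(rdot_esqrt eX) -rnorm2.
  apply: le_trans; rewrite (linear_funB lZ) (Z0 _ Ol) subr0 rdotDr rdotNr.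
  by rewrite (rdotC _ l) Ol// subr0.
rewrite rdot_short -rnorm2; apply/ler_addgt0Pr => e e0.
set b := N (P (S w)); have b0 : 0 <= b by exact: rnorm_ge0.
(* d <= 1 gives (b + d)^2 <= b^2 + d (2 b + 1), and the second bound keeps c d (2 b + 1) below e. *)
pose d := Num.min 1 (e / (c * (2 * b + 1) + 1)).
have q0 : 0 <= c * (2 * b + 1) by rewrite mulr_ge0//; lra.
have q1 : 0 < c * (2 * b + 1) + 1 by lra.
have d0 : 0 < d by rewrite lt_min ltr01 divr_gt0.
have d1 : d <= 1 by rewrite ge_min lexx.
have d2 : d * (c * (2 * b + 1) + 1) <= e by rewrite -ler_pdivlMr// ge_min lexx orbT.
have := orthog_pre_short (proj_orthog hM (S w)) => /(_ _ d0)[_ [l Ol <-]] hl.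
apply: le_trans (le _ Ol) _.
have h1 : N (S (w - l)) <= b + d.
  rewrite (linear_funB (sn_lin eX)).
  have -> : S w - S l = P (S w) + (S w - P (S w) - S l).
    by apply: rdot_inj => z; rewrite !rdotE; ring.
  by apply: le_trans (ler_rnormD _ _) _; rewrite lerD2l ltW.
have h2 : N (S (w - l)) ^+ 2 <= (b + d) ^+ 2.
  by apply: lerXn2r; rewrite // nnegrE ?rnorm_ge0// addr_ge0// ltW.
apply: le_trans (ler_wpM2l c0 h2) _.
have h3 : (b + d) ^+ 2 <= b ^+ 2 + d * (2 * b + 1) by rewrite !expr2; nra.
apply: le_trans (ler_wpM2l c0 h3) _.
by rewrite mulrDr lerD2l mulrCA; lra.
Qed.

Lemma rnorm_sn_short y : N (sn Y y) = N (P (S y)).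
Proof. by rewrite !rnorm_def rdot_esqrt ?rdot_short//; exact: short_effect. Qed.

(** Since |Y^{1/2} y| = |P S y|, the operators Y^{1/2} and S P have the same range with the same
    norm bounds on preimages. Here (S k, y) = (k, P S y) for k in M; [sn_of_short] is the
    converse. *)
Lemma sn_to_short k : L (S k) -> exists2 h, sn Y h = S k & N h <= N k.
Proof.
move=> Lk; have eY := short_effect.
have [||||h [e n _]] := @range_of_bound (sn Y) (sn Y) (S k) (N k).
- exact: sn_lin.
- exact: sn_sym.
- exact: rnorm_ge0.
- move=> y; rewrite (sn_sym eX) -{1}(proj_id hM (x := k))// (proj_sym hM).
  by rewrite rnorm_sn_short; exact: rdot_le_norm.
by exists h.
Qed.

Lemma sn_of_short h : exists k, [/\ S k = sn Y h, L (S k) & N k <= N h].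
Proof.
have eY := short_effect; have [lP sP _ _] := proj_effect hM.
have [||||k [e n _]] := @range_of_bound (S \o P) (P \o S) (sn Y h) (N h).
- by apply: linear_comp => //; exact: sn_lin.
- by move=> x y /=; rewrite (sn_sym eX) sP.
- exact: rnorm_ge0.
- move=> y; rewrite (sn_sym eY) /= -rnorm_sn_short; exact: rdot_le_norm.
exists (P k); split => //; first exact: (proj_in hM).
by apply: le_trans n; apply: effect_norm; exact: (proj_effect hM).
Qed.

Lemma range_sn_short : range (sn Y) = range S `&` L.
Proof.
apply/seteqP; split=> [_ [h _ <-]|_ [[k _ <-] Lk]].
  by have [k [<- Lk _]] := sn_of_short h; split => //; exists k.
by have [h <- _] := sn_to_short Lk; exists h.
Qed.
End Short.

(** * The inverse relation and its form *)

Definition compl (X : H -> H) (x : H) : H := x - X x.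

Lemma cs_compl X : cs (compl X) = sn X.
Proof. by rewrite /cs /sn; congr esqrt; apply/funext => x; rewrite /compl subKr. Qed.

Lemma rel_of_inv X : ((rel_of X)^-1)%relation = rel_of (compl X).
Proof.
apply/seteqP; split=> [[x y] [w [-> ->]]|[x y] [w [-> ->]]]; exists w => //=.
  by rewrite /compl subKr.
by rewrite /compl subKr.
Qed.

Section InverseForm.
Variable X : H -> H.
Hypothesis eX : effect X.
Local Notation S := (sn X).
Local Notation C := (cs X).
Local Notation K := (carrier (compl X)).
Let eX' : effect (compl X) := effectC eX.

Lemma inv_formP x : range S x -> exists2 h, K h & x = S h.
Proof.
by move=> Sx; rewrite -cs_compl; apply/(form_domP eX'); rewrite (form_dom_range eX') cs_compl.
Qed.

Lemma form_dom_inv : form_dom dot (rel_of X)^-1%relation = range S.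
Proof. by rewrite rel_of_inv (form_dom_range eX') cs_compl. Qed.

Lemma form_val_inv h k : K h -> K k ->
  form_val dot (rel_of X)^-1%relation (S h) (S k) = dot (C h) (C k).
Proof. by move=> Kh Kk; rewrite rel_of_inv -cs_compl (form_valE eX'). Qed.

Lemma rdot_inv_form h k : '[C h, C k] = '[h, k] - '[S h, S k].
Proof. by rewrite -(rdot_cs_sn eX h k) addrK. Qed.

Lemma inv_form_linear a x y z : range S x -> range S y -> range S z ->
  form_val dot (rel_of X)^-1%relation (a *: x + y) z =
  a * form_val dot (rel_of X)^-1%relation x z + form_val dot (rel_of X)^-1%relation y z.
Proof.
move=> /inv_formP[h Kh ->] /inv_formP[k Kk ->] /inv_formP[l Kl ->].
have Khk : K (a *: h + k) by apply: (carrier_csubspace eX').1.2.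
rewrite -(sn_lin eX) !form_val_inv// (cs_lin eX).
by rewrite -dotZl; exact: linearDl.
Qed.

(** For u = S h with h in K, |h|^2 = A^{-1}[u] + |u|^2. A sequence that converges in H and is Cauchy
    for the form thus has Cauchy preimages in K, and their limit is the preimage of the limit. *)
Lemma closed_inv_form L : csubspace L ->
  closed_nonneg_form (range S `&` L) (form_val dot (rel_of X)^-1%relation).
Proof.
move=> [[L0 LD] cL]; have lS := sn_lin eX; have hK := carrier_csubspace eX'.
have SD a x y : range S x -> range S y -> range S (a *: x + y).
  by move=> [h _ <-] [k _ <-]; exists (a *: h + k); rewrite ?lS.
split.
- apply/submod_closedP; split; first by split => //; exists 0 => //; exact: linear_fun0.
  by move=> a x y [Sx Lx] [Sy Ly]; split; [exact: SD|exact: LD].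
- by move=> a x y z [Sx _] [Sy _] [Sz _]; exact: inv_form_linear.
- move=> x y [/inv_formP[h Kh ->] _] [/inv_formP[k Kk ->] _].
  by rewrite !form_val_inv// dot_conj.
- move=> x [/inv_formP[h Kh ->] _].
  by rewrite form_val_inv// dotxx ler0c rdot_ge0.
move=> u x Du /tendsP ux hc.
have [h hh] := choice (fun n => let: ex_intro2 k Kk e := inv_formP (Du n).1 in
  ex_intro (fun k => K k /\ u n = S k) k (conj Kk e)).
have Kh n := (hh n).1; have uh n := (hh n).2.
have cauc (e : R) : 0 < e -> exists n0, forall m n, (n0 <= m)%N -> (n0 <= n)%N ->
    '[C (h m - h n), C (h m - h n)] < e.
  move=> e0; have e0' : (0 : R[i]) < e%:C%C by rewrite ltcR.
  have [[U V] /= [[n1 _ h1] [n2 _ h2]] hUV] := hc _ e0'.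
  exists (maxn n1 n2) => m n; rewrite !geq_max => /andP[m1 _] /andP[_ n2'].
  have /= := hUV (m, n) (conj (h1 m m1) (h2 n n2')).
  rewrite !uh -(linear_funB lS) form_val_inv ?dotxx ?ltcR//;
    exact: (subspaceB hK.1).
have hcau : exists k, tends h k.
  apply: cauchy_tends => e e0; have e2 : 0 < e ^+ 2 / 2 by rewrite divr_gt0 ?exprn_gt0.
  have [n1 h1] := cauc _ e2.
  (* Two distances e / 4 make the S part at most e^2 / 4, and e^2 / 2 + e^2 / 4 < e^2. *)
  have [n3 h3] := ux _ (divr_gt0 e0 (ltr0n _ 4)).
  exists (maxn n1 n3) => m n; rewrite !geq_max => /andP[m1 m3] /andP[k1 k3].
  rewrite -ltr_sqr ?nnegrE ?rnorm_ge0 ?ltW// rnorm2 -(rdot_cs_sn eX).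
  have := h1 _ _ m1 k1; have : '[S (h m - h n), S (h m - h n)] <= e ^+ 2 / 4.
    rewrite -rnorm2; have -> : e ^+ 2 / 4 = (e / 2) ^+ 2 by rewrite !expr2; field.
    apply: lerXn2r; rewrite ?nnegrE ?rnorm_ge0 ?ltW//.
      by lra.
    rewrite (linear_funB lS) -!uh.
    have -> : u m - u n = (u m - x) - (u n - x) by rewrite opprB addrA subrK.
    apply: le_lt_trans (ler_rnormD _ _) _; rewrite rnormN.
    by have := h3 _ m3; have := h3 _ k3; lra.
  by have := exprn_gt0 2 e0; lra.
have [k hk] := hcau.
have Kk : K k by apply: hK.2; apply: tends_rclos hk.
have xk : x = S k.
  apply: tends_uniq ux _; have := tends_contr lS (fun y => effect_norm y (sn_effect eX)) hk.
  by congr tends; apply/funext => n; rewrite uh.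
split.
  split; first by exists k.
  by apply: cL; apply: tends_rclos ux => n; case: (Du n).
move=> _ /complex_gt0P[e e0 ->].
have s0 : 0 < Num.sqrt e by rewrite sqrtr_gt0.
have [n0 hn] := hk _ s0; exists n0 => // n /hn /= {}hn.
rewrite uh xk -(linear_funB lS) form_val_inv ?dotxx ?ltcR//; try exact: (subspaceB hK.1).
apply: le_lt_trans (_ : N (h n - k) ^+ 2 < e).
  by rewrite rnorm2 rdot_inv_form gerBl rdot_ge0.
by rewrite -[ltRHS](sqr_sqrtr (ltW e0)) ltr_sqr ?nnegrE ?rnorm_ge0 ?sqrtr_ge0.
Qed.
End InverseForm.

Lemma nnsa_inv (K : set H) (A : set (H * H)) : csubspace K -> nnsa_in dot K A ->
  nnsa_in dot K A^-1%relation.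
Proof.
move=> hK /(nnsaP _ hK)[[A0 AD] AK sA pA mA]; apply/(nnsaP _ hK); split.
- by split => // a p q Ap Aq; exact: (AD a _ _ Ap Aq).
- by move=> p /AK[].
- by move=> p q Ap Aq; have := sA _ _ Ap Aq.
- by move=> p /pA; rewrite rdotC.
- by move=> x y Kx Ky h; apply: mA => // p Ap; have := h (p.2, p.1); case: p Ap => p1 p2 Ap /(_ Ap).
Qed.

(** * The part of the maximal relation in L *)

Section ShortForm.
Variables (X : H -> H) (L : set H).
Hypotheses (eX : effect X) (hL : csubspace L).
Local Notation S := (sn X).
Local Notation Y := (short X L).
Let eY : effect Y := short_effect eX hL.

Lemma rel_restr_short :
  rel_restr (rel_of Y) L = [set p | exists2 w, L w & p = (w - Y w, Y w)].
Proof.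
apply/seteqP; split=> [_ [[w ->] [_ /= Lw]]|_ [w Lw ->]].
  exists w => //; rewrite -(subrK (Y w) w).
  by apply: subspaceD hL.1 Lw _; exact: short_in.
have Aw : rel_of Y (w - Y w, Y w) by exists w.
split => //; split; first by exists (w - Y w, Y w).
by apply: subspaceB hL.1 Lw _; exact: short_in.
Qed.

Lemma rel_restr_short_nnsa : nnsa_in dot L (rel_restr (rel_of Y) L).
Proof.
have [sL _] := hL; have [lY sY _ _] := eY.
have [_ _ sA pA _] := (nnsaP _ csubspaceT).1 (rel_of_nnsa eY).
rewrite rel_restr_short; apply/(nnsaP _ hL); split.
- split; first by exists 0; [exact: sL.1|rewrite (linear_fun0 lY) subr0].
  move=> a _ _ [u Lu ->] [v Lv ->]; exists (a *: u + v); first exact: sL.2.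
  by congr pair; rewrite /= lY// scalerBr opprD addrACA.
- move=> _ [w Lw ->]; have LY := short_in eX hL w.
  by split => //=; exact: (subspaceB sL).
- by move=> _ _ [u _ ->] [v _ ->]; apply: sA; [exists u|exists v].
- by move=> _ [u _ ->]; apply: pA; exists u.
- move=> x y Lx Ly h; have Lxy := subspaceD sL Lx Ly; exists (x + y) => //.
  suff -> : Y (x + y) = y by rewrite addrK.
  apply/subr0_eq/rdot_eq0; set d := Y (x + y) - y.
  have Ld : L d by apply: (subspaceB sL) => //; exact: short_in.
  have /= := h _ (ex_intro2 _ _ d Ld erefl).
  rewrite rdotDl rdotNl !sY => e.
  by rewrite {2}/d (linear_funD lY) !rdotDr rdotNr e; ring.
Qed.

(** Y vanishes on the complement of L, so vectors of L already produce all of ran Y, and the closure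
    of ran Y lies in L. Hence the inverses taken in L and in H carry the same form. *)
Lemma op_part_rel_restr_short :
  op_part (rel_restr (rel_of Y) L)^-1%relation = op_part (rel_of Y)^-1%relation.
Proof.
have [lY _ _ _] := eY.
have ed : rel_dom (rel_restr (rel_of Y) L)^-1%relation = rel_dom (rel_of Y)^-1%relation.
  apply/seteqP; split=> [_ [p [Ap _] <-]|_ [[x y] [w [e1 e2]] <-]]; first by exists p.
  (* Here x = Y w = Y (P_L w), so w may be replaced by its projection. *)
  exists (x, proj L w - x) => //=; rewrite rel_restr_short.
  have -> : x = Y (proj L w).
    rewrite /= in e2; rewrite e2; apply/subr0_eq; rewrite -(linear_funB lY).
    exact/(short_orthog eX hL)/(proj_orthog hL).
  by exists (proj L w) => //; exact: (proj_in hL).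
rewrite /op_part ed; set K := closure _.
have KL : K `<=` L.
  rewrite /K closureE => x /rclos_tends[u hu ux]; apply: hL.2.
  apply: tends_rclos ux => n; have [[a b] [w [_ /= e]] <- /=] := hu n.
  by rewrite e; exact: short_in.
apply/seteqP; split=> [p [[Ap _] Kp]|[x y] [[w [/= ey ex]] [/= Kx Ky]]]; first by [].
split => //; rewrite rel_restr_short; exists w; last by rewrite ey ex.
rewrite -(subrK (Y w) w) -ey -ex; apply: subspaceD hL.1 _ _; exact: KL.
Qed.

(** Least-norm preimages of one vector of L under Y^{1/2} and S have equal norms, each being bounded
    by a preimage of the other kind; polarization extends this to inner products. *)
Lemma rdot_short_form h h' k k' :
  carrier (compl Y) h -> carrier (compl Y) h' ->
  carrier (compl X) k -> carrier (compl X) k' ->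
  sn Y h = S k -> sn Y h' = S k' -> L (S k) -> L (S k') -> '[h, h'] = '[k, k'].
Proof.
move=> Kh Kh' Kk Kk' e e' Lk Lk'.
have hX := effectC eX; have hY := effectC eY.
have norm a b : carrier (compl Y) a -> carrier (compl X) b -> sn Y a = S b -> L (S b) ->
    '[a, a] = '[b, b].
  move=> Ka Kb eab Lb; apply/eqP; rewrite eq_le; apply/andP; split.
    have [c ec nc] := sn_to_short eX hL Lb.
    apply: le_trans (rdot_mono nc); apply: (carrier_min hY) => //.
    by rewrite cs_compl eab ec.
  have [c [ec _ nc]] := sn_of_short eX hL a.
  apply: le_trans (rdot_mono nc); apply: (carrier_min hX) => //.
  by rewrite cs_compl ec eab.
have := norm (h + h') (k + k').
rewrite !(linear_funD (sn_lin eX)) (linear_funD (sn_lin eY)) e e' !rdotE.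
rewrite (norm h k)// (norm h' k')// (rdotC h' h) (rdotC k' k).
have [sKX _] := carrier_csubspace hX; have [sKY _] := carrier_csubspace hY.
move=> /(_ (subspaceD sKY Kh Kh') (subspaceD sKX Kk Kk') erefl (subspaceD hL.1 Lk Lk')).
lra.
Qed.

Lemma form_val_short x y : (range S `&` L) x -> (range S `&` L) y ->
  form_val dot (rel_of Y)^-1%relation x y = form_val dot (rel_of X)^-1%relation x y.
Proof.
move=> [Sx Lx] [Sy Ly].
have /(inv_formP eY)[h Kh xh] : range (sn Y) x by rewrite (range_sn_short eX hL).
have /(inv_formP eY)[h' Kh' yh'] : range (sn Y) y by rewrite (range_sn_short eX hL).
have [k Kk xk] := inv_formP eX Sx; have [k' Kk' yk'] := inv_formP eX Sy.
rewrite {1}xh {1}yh' xk yk' (form_val_inv eX)// (form_val_inv eY)//.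
have lSX := linear_funZ (sn_lin eX); have lSY := linear_funZ (sn_lin eY).
have lCX := linear_funZ (cs_lin eX); have lCY := linear_funZ (cs_lin eY).
have [sKX _] := carrier_csubspace (effectC eX); have [sKY _] := carrier_csubspace (effectC eY).
rewrite !dotE -lCX -lCY !(rdot_inv_form eX) !(rdot_inv_form eY) lSX lSY -xh -xk -yh' -yk'.
have e : sn Y h = S k by rewrite -xh.
have e' : sn Y h' = S k' by rewrite -yh'.
(* The imaginary part of the form is the real identity for i h' and i k'. *)
have ei : sn Y ('i%C *: h') = S ('i%C *: k') by rewrite lSX lSY e'.
have Lk : L (S k) by rewrite -xk.
have Lk' : L (S k') by rewrite -yk'.
have Lik' : L (S ('i%C *: k')) by rewrite lSX; exact: subspaceZ hL.1 Lk'.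
rewrite (rdot_short_form Kh Kh' Kk Kk')//.
have Kih' : carrier (compl Y) ('i%C *: h') by exact: subspaceZ sKY Kh'.
have Kik' : carrier (compl X) ('i%C *: k') by exact: subspaceZ sKX Kk'.
by rewrite (rdot_short_form Kh Kih' Kk Kik' e ei Lk Lik').
Qed.

Lemma associated_short :
  associated_in dot L (rel_restr (rel_of Y) L)^-1%relation
    (range S `&` L) (form_val dot (rel_of X)^-1%relation).
Proof.
have ed : form_dom dot (rel_restr (rel_of Y) L)^-1%relation = range S `&` L.
  rewrite /form_dom op_part_rel_restr_short -/(form_dom _ _) (form_dom_inv eY).
  exact: range_sn_short.
split=> //; [exact: nnsa_inv rel_restr_short_nnsa|exact: closed_inv_form|].
move=> x y Dx Dy; rewrite -form_val_short//.
by rewrite /form_val op_part_rel_restr_short.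
Qed.
End ShortForm.

(** * Graphs and the Cayley transform *)

Lemma eq_rel_of X Y : (forall w, X w = Y w) -> rel_of X = rel_of Y.
Proof. by move=> h; congr rel_of; apply/funext. Qed.

Lemma rel_of_mulP X y : rel_mul (rel_of X) y <-> X y = y.
Proof.
split=> [[w [/esym/subr0_eq e ->]]|e]; first by rewrite -e.
by exists y; rewrite e subrr.
Qed.

Lemma graph_nnsa (T : H -> H) : linear T -> symmetric_fun T ->
  (forall x, 0 <= '[T x, x]) -> nnsa_in dot setT (rel_graph T).
Proof.
move=> lT sT pT; apply/(nnsaP _ csubspaceT); split => //.
- split; first by rewrite /rel_graph /= (linear_fun0 lT).
  by move=> a p q; rewrite /rel_graph /= lT => -> ->.
- by move=> p q -> ->; exact: sT.
- by move=> p ->.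
- move=> x y _ _ h; rewrite /rel_graph /=; apply: rdot_inj => z.
  by rewrite sT rdotC -(h (z, T z))// rdotC.
Qed.

Lemma graph_nnsaP (T : H -> H) : nnsa_in dot setT (rel_graph T) ->
  [/\ linear T, symmetric_fun T & forall x, 0 <= '[T x, x]].
Proof.
move=> /(nnsaP _ csubspaceT)[[_ lA] _ sA pA _]; split.
- by move=> a x y; have := lA a (x, T x) (y, T y) erefl erefl.
- by move=> x y; exact: (sA (x, T x) (y, T y) erefl erefl).
- by move=> x; exact: (pA (x, T x) erefl).
Qed.

(** With x = C^2 w and y = S^2 w, A[x] = |S C w|^2 = (y, x). This makes [rel_le] between graphs the
    usual order of operators, without computing their square roots. *)
Lemma form_val_rel A x y : nnsa_in dot setT A -> A (x, y) ->
  form_dom dot A x /\ form_val dot A x x = '[y, x]%:C%C.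
Proof.
move=> /nnsa_rel_of[X eX ->] [w [-> ->]]; rewrite -(csK eX) -(snK eX).
have Kh := cs_carrier eX w; split; first by apply/(form_domP eX); exists (cs X w).
rewrite form_valE// dotxx (sncs eX); congr (_%:C)%C.
by rewrite [RHS](sn_sym eX) !(sncs eX) [RHS]rdotC (cs_sym eX) rdotC.
Qed.

Lemma rel_le_graph (T U : H -> H) :
  nnsa_in dot setT (rel_graph T) -> nnsa_in dot setT (rel_graph U) ->
  rel_le dot (rel_graph T) (rel_graph U) <-> forall x, '[T x, x] <= '[U x, x].
Proof.
move=> nT nU.
have fT x := form_val_rel (x := x) (y := T x) nT erefl.
have fU x := form_val_rel (x := x) (y := U x) nU erefl.
split=> [[_ h] x|h]; first by have := h x (fU x).1; rewrite (fT x).2 (fU x).2 lecR.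
split=> x _; first exact: (fT x).1.
by rewrite (fT x).2 (fU x).2 lecR.
Qed.

Lemma Bplus_graph (T : H -> H) (M : R) : linear T -> (forall x, N (T x) <= M * N x) ->
  nnsa_in dot setT (rel_graph T) -> Bplus dot (rel_graph T).
Proof.
move=> lT bT nT; split => //.
pose T' : {linear H -> H} := HB.pack T (GRing.isLinear.Build _ _ _ _ _ lT).
exists T' => //; exists M%:C%C => x.
by rewrite !normC -rmorphM lecR; exact: bT.
Qed.

Lemma rel_graphP (f : H -> H) x y : rel_graph f (x, y) <-> y = f x.
Proof. by []. Qed.

Lemma rel_scale_graph a (f : H -> H) : rel_scale a (rel_graph f) = rel_graph (fun x => a *: f x).
Proof.
apply/seteqP; split=> [_ [p pf <-]|[x y] /= e]; first by rewrite /rel_graph /= pf.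
by exists (x, f x) => //; move: e; rewrite /rel_graph /= => ->.
Qed.

Lemma rel_add_graph (f g : H -> H) :
  rel_add (rel_graph f) (rel_graph g) = rel_graph (fun x => f x + g x).
Proof.
apply/seteqP; split=> [p [y [z [fy gz e]]]|p e].
  by move: fy gz e; rewrite /rel_graph /= => -> ->.
by exists (f p.1), (g p.1).
Qed.

Lemma rel_sub_graph (f g : H -> H) :
  rel_sub (rel_graph f) (rel_graph g) = rel_graph (fun x => f x - g x).
Proof.
rewrite /rel_sub rel_scale_graph rel_add_graph; congr rel_graph.
by apply/funext => x; rewrite scaleN1r.
Qed.

Lemma scale2r (x : H) : 2 *: x = x + x.
Proof. by rewrite scaler_nat mulr2n. Qed.

Lemma cayley_rel_of X : cayley (rel_of X) = rel_graph (fun x => x - 2 *: X x).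
Proof.
have e : (rel_add (rel_graph idfun) (rel_of X))^-1%relation = rel_graph (fun x => x - X x).
  apply/seteqP; split=> [[x y] [a [b [/= /rel_graphP -> [w [-> ->]] ->]]]|[x y] /rel_graphP ->].
    by rewrite /rel_graph /= subrK.
  exists (x - X x), (X x); split => //=; first by exists x.
  by rewrite subrK.
rewrite /cayley e !rel_scale_graph rel_add_graph; congr rel_graph.
apply/funext => x; apply: rdot_inj => z; rewrite scaleN1r !scale2r !rdotE; ring.
Qed.

Lemma rel_sub_cayley X :
  rel_sub (rel_graph idfun) (cayley (rel_of X)) = rel_graph (fun x => 2 *: X x).
Proof.
by rewrite cayley_rel_of rel_sub_graph; congr rel_graph; apply/funext => x; rewrite subKr.
Qed.

(** For T = I - 2 Y the pair ((I + T) f, (I - T) f) is (w - Y w, Y w) with w = 2 f. *)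
Lemma cayley_contraction_graph Y : linear Y ->
  cayley_contraction (rel_sub (rel_graph idfun) (rel_graph (fun x => 2 *: Y x))) = rel_of Y.
Proof.
move=> lY; rewrite rel_sub_graph; apply/seteqP; split=> [_ [[x _] /rel_graphP -> <-]|_ [w ->]].
  exists (2 *: x) => /=; rewrite (linear_funZ lY); congr pair; last by rewrite subKr.
  by rewrite (scale2r x) addrA.
have e2 : 2 *: (2^-1 *: w) = w by rewrite scalerA divff ?scale1r// pnatr_eq0.
exists (2^-1 *: w, 2^-1 *: w - Y w); last first.
  by rewrite /= subKr addrA -scale2r e2.
by rewrite /rel_graph /= -(linear_funZ lY) e2.
Qed.

(** * The maximal element and its properties *)

Section ShortRelation.
Variables (X : H -> H) (L : set H).
Hypotheses (eX : effect X) (hL : csubspace L).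
Local Notation S := (sn X).
Local Notation C := (cs X).
Local Notation M := (pre_short X L).
Local Notation P := (proj M).
Local Notation Y := (short X L).
Let eY : effect Y := short_effect eX hL.
Let hM : csubspace M := pre_short_csubspace eX hL.

Lemma greatest_Xi : unique (greatest_of dot (Xi dot (rel_of X) L)) (rel_of Y).
Proof.
have YXi : Xi dot (rel_of X) L (rel_of Y).
  split; first exact: rel_of_nnsa.
    by apply/rel_leP => // w; exact: short_le.
  by move=> _ [_ [w ->] <-]; exact: short_in.
have gY : greatest_of dot (Xi dot (rel_of X) L) (rel_of Y).
  split => // B [/nnsa_rel_of[Z eZ ->] /(rel_leP eZ eX) ZX ZL].
  apply/rel_leP => // w; have [lZ sZ _ _] := eZ; rewrite -[leRHS]mul1r.
  apply: short_max => // v; first by rewrite mul1r.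
  by apply: ZL; exists (v - Z v, Z v) => //; exists v.
split=> // B [BXi gB]; have [/nnsa_rel_of[Z eZ e] _ _] := BXi; subst B.
have h1 := (rel_leP eZ eY).1 (gY.2 _ BXi); have h2 := (rel_leP eY eZ).1 (gB _ YXi).
apply/eq_rel_of/effect_ext => // w; apply/eqP.
by rewrite eq_le h1 h2.
Qed.

Lemma shorted_graph :
  shorted dot (rel_graph (fun x => 2 *: X x)) L = rel_graph (fun x => 2 *: Y x).
Proof.
have G Z : effect Z -> nnsa_in dot setT (rel_graph (fun x => 2 *: Z x)).
  move=> [lZ sZ pZ _]; apply: graph_nnsa.
  - by move=> a x y; rewrite lZ scalerDr !scalerA mulrC.
  - by move=> x y; rewrite !scale2r !rdotE sZ.
  - by move=> x; rewrite scale2r rdotDl addr_ge0.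
have BY : Bplus dot (rel_graph (fun x => 2 *: Y x)).
  apply: (@Bplus_graph _ 2) => [a x y|x|]; last exact: G.
    by have [lY _ _ _] := eY; rewrite lY scalerDr !scalerA mulrC.
  rewrite scale2r; apply: le_trans (ler_rnormD _ _) _.
  by have := effect_norm x eY; lra.
have leY : rel_le dot (rel_graph (fun x => 2 *: Y x)) (rel_graph (fun x => 2 *: X x)).
  apply/rel_le_graph; [exact: G|exact: G|move=> x].
  by rewrite !scale2r !rdotDl; have := short_le eX hL x; lra.
have ranY : rel_ran (rel_graph (fun x => 2 *: Y x)) `<=` L.
  by move=> _ [[x _] /rel_graphP -> <-]; apply: subspaceZ hL.1 _; exact: short_in.
have gY : forall B, [/\ Bplus dot B, rel_le dot B (rel_graph (fun x => 2 *: X x)) &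
    rel_ran B `<=` L] -> rel_le dot B (rel_graph (fun x => 2 *: Y x)).
  move=> B [[nB [T _ e]] ]; subst B => le ran; have [lT sT pT] := graph_nnsaP nB.
  apply/rel_le_graph => //; first exact: G.
  move=> x; rewrite scale2r rdotDl -[leRHS]mulr2n -mulr_natl.
  (* Here c = 2, because I minus the Cayley transform is 2 X; the competitor T is bounded by 2 X
     rather than by X. *)
  apply: short_max => // w.
    by have := (rel_le_graph nB (G _ eX)).1 le w; rewrite scale2r rdotDl; lra.
  by apply: ran; exists (w, T w).
apply: xget_unique; first by split.
move=> B [BP gB]; have := gY B BP; have := gB _ (And3 BY leY ranY).
case: BP => -[nB [T _ e]] _ _; subst B => /(rel_le_graph (G _ eY) nB) h1.
move=> /(rel_le_graph nB (G _ eY)) h2; have [lT sT pT] := graph_nnsaP nB.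
have [lG sG _] := graph_nnsaP (G _ eY).
congr rel_graph; apply/funext => x; apply/subr0_eq.
apply: (symmetric_eq0 (T := fun x => T x - 2 *: Y x)) => [|u v|u].
- exact: linear_sub.
- by rewrite rdotDl rdotNl rdotDr rdotNr sT sG.
- by rewrite rdotDl rdotNl; have := h1 u; have := h2 u; lra.
Qed.

Lemma range_sn_short_eq0 : rel_of Y = rel_graph (fun=> 0) <-> range S `&` L = [set 0].
Proof.
have [lY _ _ _] := eY; rewrite -(range_sn_short eX hL); split=> [e|e].
  have Y0 w : Y w = 0.
    have : rel_of Y (w - Y w, Y w) by exists w.
    by rewrite e.
  apply/seteqP; split=> [_ [h _ <-]|_ ->].
    exact/(esqrt_eq0 eY).
  by exists 0 => //; exact: linear_fun0 (sn_lin eY).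
have Y0 w : Y w = 0.
  apply/(esqrt_eq0 eY); have : range (sn Y) (sn Y w) by exists w.
  by rewrite e.
apply/seteqP; split=> [_ [w ->]|[x y] /rel_graphP ->]; first by rewrite /rel_graph /= Y0.
by exists x; rewrite Y0 subr0.
Qed.

(** If Y y = y then 0 <= ((I - X) y, y) <= ((I - Y) y, y) = 0. Fixed vectors are the multivalued
    part, so this gives (4). *)
Lemma short_fix y : Y y = y <-> X y = y /\ L y.
Proof.
have [lX sX pX cX] := effectC eX; split=> [h|[h Ly]].
  split; last by rewrite -h; exact: short_in.
  apply/esym/subr0_eq/(psd_eq0 (T := fun y => y - X y)) => //.
  have := short_le eX hL y; have := cX y; have := pX y; rewrite h !rdotDl !rdotNl; lra.
have Sy := sn_fix eX h.
by rewrite /short Sy (proj_id hM) ?Sy// /pre_short /= Sy.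
Qed.

Lemma rel_mul_short : rel_mul (rel_of Y) = rel_mul (rel_of X) `&` L.
Proof.
apply/seteqP; split=> y.
  by move=> /rel_of_mulP/short_fix[h Ly]; split => //; exact/rel_of_mulP.
by move=> [/rel_of_mulP h Ly]; apply/rel_of_mulP/short_fix.
Qed.

Lemma sqrt_preimage_rel_of : sqrt_preimage dot (rel_of X) L = C @` M.
Proof.
rewrite /sqrt_preimage (rel_sqrt_rel_of eX) (form_dom_range eX).
apply/seteqP; split=> [x [_ [y Ly [h [-> e]]]]|_ [h Mh <-]].
  by exists h => //; rewrite /pre_short /= -e.
by split; [exists h|exists (S h) => //; exists h].
Qed.

Lemma cs_image_subspace : subspace (C @` M).
Proof.
split; first by exists 0; [exact: hM.1.1|exact: linear_fun0 (cs_lin eX)].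
move=> a _ _ [u Mu <-] [v Mv <-]; exists (a *: u + v); first exact: hM.1.2.
by rewrite (cs_lin eX).
Qed.

(* For h in M, (I - Y) S h = S P C^2 h, so a lower bound for I - Y bounds S h,
   hence h, in terms of C h. *)
Lemma closed_of_Bplus : Bplus dot (rel_of Y) -> rclos (C @` M) `<=` C @` M.
Proof.
move=> [_ [T [m bT] e]]; have [lS lC] := (sn_lin eX, cs_lin eX).
have [lP _ _ _] := proj_effect hM.
have m0 : exists2 c : R, 0 <= c & forall x, N (T x) <= c * N x.
  case: m bT => a b bT; exists `|a| => [//|x].
  have := bT x; rewrite !normC lecE /= => /andP[_]; rewrite mulr0 subr0 => h.
  by apply: le_trans h _; rewrite ler_wpM2r ?rnorm_ge0 ?ler_norm.
have [c c0 hc] := m0.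
(* w = (w - Y w) + T (w - Y w). *)
have below w : N w <= (1 + c) * N (w - Y w).
  have : rel_of Y (w - Y w, Y w) by exists w.
  rewrite e => /rel_graphP eT; rewrite -[in leLHS](subrK (Y w) w).
  apply: le_trans (ler_rnormD _ _) _; rewrite {2}eT mulrDl mul1r lerD2l; exact: hc.
(* |h|^2 = |C h|^2 + |S h|^2 <= (1 + (1 + c)^2) |C h|^2, and the factor is at most (2 + c)^2. *)
have hMC h : M h -> N h <= (2 + c) * N (C h).
  move=> Mh; have h1 := below (S h).
  have e1 : S h - Y (S h) = S (P (C (C h))).
    by rewrite /short (snK eX) (csK eX) (linear_funB lP) (proj_id hM Mh) (linear_funB lS).
  have h2 : N (S h - Y (S h)) <= N (C h).
    rewrite e1; apply: le_trans (effect_norm _ (sn_effect eX)) _.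
    apply: le_trans (effect_norm _ (proj_effect hM)) _.
    exact: effect_norm (cs_effect eX).
  have h3 : N (S h) <= (1 + c) * N (C h).
    by apply: le_trans h1 _; rewrite ler_wpM2l// addr_ge0.
  have := rdot_cs_sn eX h h; rewrite -!rnorm2 => h4.
  rewrite -ler_sqr ?nnegrE ?mulr_ge0 ?rnorm_ge0 ?addr_ge0// -h4.
  have := rnorm_ge0 (C h); have := rnorm_ge0 (S h); rewrite !expr2; nra.
move=> z /rclos_tends[u hu uz].
have [h hh] := choice (fun n => let: ex_intro2 k Mk e := hu n in
  ex_intro (fun k => M k /\ u n = C k) k (conj Mk (esym e))).
have [k hk] : exists k, tends h k.
  apply: cauchy_tends => d d0; have q : 0 < 2 * (2 + c) by rewrite mulr_gt0// ltr_pwDl.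
  have [n0 hn] := uz _ (divr_gt0 d0 q).
  exists n0 => i j hi hj; have [[Mi ui] [Mj uj]] := (hh i, hh j).
  apply: le_lt_trans (hMC _ (subspaceB hM.1 Mi Mj)) _.
  rewrite (linear_funB lC) -ui -uj.
  have -> : u i - u j = (u i - z) - (u j - z) by rewrite opprB addrA subrK.
  have := ler_rnormD (u i - z) (- (u j - z)); rewrite rnormN.
  by have := hn _ hi; have := hn _ hj; rewrite !ltr_pdivlMr//; nra.
exists k; first by apply: hM.2; apply: tends_rclos hk => n; case: (hh n).
apply: tends_uniq (tends_contr lC (fun y => effect_norm y (cs_effect eX)) hk) _.
by move: uz; congr tends; apply/funext => n /=; case: (hh n).
Qed.
End ShortRelation.

(** * Closed ranges and boundedness *)

Lemma bernoulli_third n : 1 + n%:R / 3 <= (4 / 3) ^+ n :> R.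
Proof.
elim: n => [|n h]; first by rewrite mul0r addr0 expr0.
rewrite exprS -natr1; have : 0 <= n%:R :> R by []; lra.
Qed.

(* Gliding hump: unit vectors u_n in the range of T with |T' u_n| < 4^-n would
   give a vector x = sum_n (+/- 3^-n u_n) in the range with |(x, u_n)| >= 3^-n / 2. *)
Lemma closed_range_bound (T T' : H -> H) : linear T -> linear T' ->
  (forall x y, '[T x, y] = '[x, T' y]) -> rclos (range T) `<=` range T ->
  exists2 c : R, 1 <= c & forall y, range T y -> N y <= c * N (T' y).
Proof.
move=> lT lT' adj cT; apply: contrapT => hno.
have sT : subspace (range T).
  split; first by exists 0 => //; exact: linear_fun0.
  by move=> a _ _ [x _ <-] [y _ <-]; exists (a *: x + y); rewrite ?lT.
have hu n : exists u, [/\ range T u, N u = 1 & 4 ^+ n * N (T' u) < 1].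
  apply: contrapT => hn; apply: hno; exists (4 ^+ n); first by rewrite exprn_ege1// ler1n.
  move=> y Ty; rewrite leNgt; apply/negP => hy; apply: hn.
  have y0 : 0 < N y by apply: le_lt_trans hy; rewrite mulr_ge0 ?rnorm_ge0// exprn_ge0.
  exists ((N y)^-1%:C%C *: y); split; first exact: subspaceZ.
    by rewrite rnormZ ger0_norm ?invr_ge0 ?ltW// mulVf// gt_eqF.
  rewrite (linear_funZ lT') rnormZ ger0_norm ?invr_ge0 ?ltW//.
  by rewrite mulrCA mulrC ltr_pdivrMr// mul1r.
have {hu}[u hu] := choice hu.
have p3 n : 0 < 3^-1 ^+ n :> R by rewrite exprn_gt0.
(* The sign is chosen so that adding the term cannot cancel (x_n, u_n). *)
pose s (x : H) n : R := if 0 <= '[x, u n] then 3^-1 ^+ n else - 3^-1 ^+ n.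
pose fix x n := if n is n'.+1 then x n' + (s (x n') n')%:C%C *: u n' else 0.
have sn0 n : `|s (x n) n| = 3^-1 ^+ n.
  by rewrite /s; case: ifP => _; rewrite ?normrN ger0_norm// ltW.
have xu n : 3^-1 ^+ n <= `|'[x n.+1, u n]|.
  rewrite /= rdotDl rdotZl -rnorm2; have [_ -> _] := hu n; rewrite expr1n mulr1 /s.
  case: ifPn => [h|]; first by apply: le_trans (ler_norm _); rewrite lerDr.
  by rewrite -ltNge => h; rewrite -normrN; apply: le_trans (ler_norm _); lra.
have xT n : range T (x n).
  elim: n => [|n h] /=; first exact: sT.1.
  by have [Tu _ _] := hu n; exact: subspaceD sT h (subspaceZ _ sT Tu).
have xd m n : (n <= m)%N -> N (x m - x n) <= 3 / 2 * (3^-1 ^+ n - 3^-1 ^+ m).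
  move=> /subnK <-; elim: (m - n)%N => [|k h]; first by rewrite !subrr rnorm0 mulr0.
  rewrite addSn /= addrAC; apply: le_trans (ler_rnormD _ _) _.
  rewrite rnormZ sn0; have [_ -> _] := hu (k + n)%N; rewrite mulr1 exprS.
  by move: h; lra.
have xc m n : (n <= m)%N -> N (x m - x n) <= 3 / 2 * 3^-1 ^+ n.
  by move=> /xd; have := p3 m; lra.
have [z hz] : exists z, tends x z.
  apply: cauchy_tends => e e0.
  have [n0 hn0] := exists_inv_lt (divr_gt0 e0 (ltr0n _ 3)).
  have small : 3^-1 ^+ n0 < e / 3 :> R.
    apply: le_lt_trans (hn0 _ (leqnn _)); rewrite exprVn lef_pV2 ?posrE ?exprn_gt0//.
    by rewrite -natrX ler_nat ltn_expl.
  exists n0 => m n hm hn; rewrite -[x m](subrK (x n0)) -addrA.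
  apply: le_lt_trans (ler_rnormD _ _) _; rewrite -(opprB (x n)) rnormN.
  by have := xc _ _ hm; have := xc _ _ hn; lra.
have [k _ Tk] : range T z by apply: cT; apply: tends_rclos hz.
(* The tail (3/2) 3^-(n+1) is half of the 3^-n secured at step n, so |(z, u_n)| >= 3^-n / 2. *)
have zx n : N (z - x n.+1) <= 3^-1 ^+ n / 2.
  apply/ler_addgt0Pr => e e0; have [n0 hn0] := hz _ e0.
  rewrite -[z](subrK (x (maxn n0 n.+1))) -addrA.
  apply: le_trans (ler_rnormD _ _) _; rewrite -opprB rnormN.
  have := hn0 _ (leq_maxl n0 n.+1); have := xc _ _ (leq_maxr n0 n.+1).
  by rewrite exprS; lra.
have bound n : (4 / 3) ^+ n <= 2 * N k.
  have [_ nu Tu] := hu n.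
  have h1 : 3^-1 ^+ n / 2 <= N k * N (T' (u n)).
    apply: le_trans (cauchy_schwarz _ _); rewrite -adj Tk.
    have := xu n; have -> : '[x n.+1, u n] = '[z, u n] - '[z - x n.+1, u n].
      by rewrite rdotDl rdotNl; ring.
    have := ler_normB '[z, u n] '[z - x n.+1, u n].
    have := cauchy_schwarz (z - x n.+1) (u n); rewrite nu mulr1.
    by have := zx n; lra.
  have h2 : 4 ^+ n * (3^-1 ^+ n / 2) <= 4 ^+ n * (N k * N (T' (u n))).
    by rewrite ler_wpM2l// exprn_ge0.
  have h3 : N k * (4 ^+ n * N (T' (u n))) <= N k * 1.
    by rewrite ler_wpM2l ?rnorm_ge0// ltW.
  by rewrite exprMn; move: h2; rewrite [4 ^+ n * (N k * _)]mulrCA mulrA; lra.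
(* For n > 6 |k|, 1 + n / 3 exceeds 2 |k|. *)
have hb := archi_boundP (mulr_ge0 (ler0n _ 6) (rnorm_ge0 k)).
have := le_trans (bernoulli_third _) (bound (Num.bound (6 * N k))).
by lra.
Qed.

Section BoundedShort.
Variables (X : H -> H) (L : set H).
Hypotheses (eX : effect X) (hL : csubspace L).
Local Notation S := (sn X).
Local Notation C := (cs X).
Local Notation M := (pre_short X L).
Local Notation P := (proj M).
Local Notation Y := (short X L).
Let eY : effect Y := short_effect eX hL.
Let hM : csubspace M := pre_short_csubspace eX hL.

(** A closed range of C P makes its adjoint P C bounded below on that range, and P C vanishes on the
    complement. By duality C h = C P k with |k| <= c |C h|, and injectivity on M gives h = P k. *)
Lemma cs_bounded_below : rclos (C @` M) `<=` C @` M ->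
  (forall h, M h -> C h = 0 -> h = 0) ->
  exists2 c : R, 1 <= c & forall h, M h -> N h <= c * N (C h).
Proof.
move=> clo inj; have [lP sP _ _] := proj_effect hM.
have lC := cs_lin eX; have sC := cs_sym eX.
have eR : range (C \o P) = C @` M.
  apply/seteqP; split=> [_ [h _ <-]|_ [h Mh <-]].
    by exists (P h) => //; exact: (proj_in hM).
  by exists h => //=; rewrite (proj_id hM).
have lT : linear (C \o P) by exact: linear_comp.
have lT' : linear (P \o C) by exact: linear_comp.
have adj x y : '[(C \o P) x, y] = '[x, (P \o C) y] by rewrite /= sC sP.
have [|c c1 hc] := closed_range_bound lT lT' adj; first by rewrite eR.
have hR : csubspace (range (C \o P)).
  by rewrite eR; split => //; exact: (cs_image_subspace eX hL).
exists c => // h Mh; have c0 : 0 <= c by lra.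
have Rz : range (C \o P) (C h) by rewrite eR; exists h.
have [|y|k [e n _]] := @range_of_bound (C \o P) (P \o C) (C h) (c * N (C h)) lT' adj.
- by rewrite mulr_ge0 ?rnorm_ge0.
- have Rp := proj_in hR y; set p := proj _ y in Rp.
  have -> : '[C h, y] = '[C h, p].
    have := proj_orthog hR y Rz; rewrite -/p rdotDl rdotNl.
    by rewrite (rdotC y) (rdotC p); lra.
  have -> : (P \o C) y = (P \o C) p.
    apply/subr0_eq; rewrite -(linear_funB lT'); apply: rdot_inj => z.
    by rewrite rdot0l rdotC -adj rdotC; apply: (proj_orthog hR y); exists z.
  apply: le_trans (rdot_le_norm _ _) _; rewrite mulrAC mulrC.
  by rewrite ler_wpM2r ?rnorm_ge0//; exact: hc.
suff e1 : h = P k by rewrite {1}e1; apply: le_trans (effect_norm _ (proj_effect hM)) n.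
apply/subr0_eq/inj; first exact: subspaceB hM.1 Mh (proj_in hM _).
by rewrite (linear_funB lC) -e subrr.
Qed.

(* With h = P S w and |h| <= c |C h|: ((I - Y) w, w) = |w|^2 - |h|^2 and
   |h|^4 = (w, S h)^2 <= |w|^2 (|h|^2 - |C h|^2) <= (1 - c^-2) |w|^2 |h|^2. *)
Lemma Bplus_of_closed : rclos (C @` M) `<=` C @` M ->
  (forall h, M h -> C h = 0 -> h = 0) -> Bplus dot (rel_of Y).
Proof.
move=> clo inj; have [c c1 hc] := cs_bounded_below clo inj.
have [lP sP _ _] := proj_effect hM; have [lY sY _ _] := eY.
have c0 : 0 < c by lra.
pose Z w := w - Y w; have [lZ sZ _ _] : effect Z := effectC eY.
have below w : '[w, w] <= c ^+ 2 * '[Z w, w].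
  set h := P (S w); have Mh : M h by exact: (proj_in hM).
  have e1 : '[Y w, w] = '[h, h] by rewrite (rdot_short eX hL).
  have h2 : '[h, h] <= c ^+ 2 * '[C h, C h].
    rewrite -!rnorm2 -exprMn; apply: lerXn2r (hc _ Mh); rewrite nnegrE ?rnorm_ge0//.
    by rewrite mulr_ge0 ?rnorm_ge0 ?(ltW c0).
  have h3 := rdot_cs_sn eX h h.
  have h4 : '[h, h] ^+ 2 <= '[w, w] * '[S h, S h].
    have -> : '[h, h] = '[w, S h] by rewrite -e1 rdotC /short.
    rewrite -!rnorm2 -exprMn -real_normK ?num_real//.
    by apply: lerXn2r; rewrite ?nnegrE ?mulr_ge0 ?rnorm_ge0//; exact: cauchy_schwarz.
  rewrite /Z rdotDl rdotNl e1.
  have p1 := rdot_ge0 h; have p2 := rdot_ge0 w; have p3 := rdot_ge0 (S h).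
  move: e1 h2 h3 h4 p1 p2 p3 => _; move: '[h, h] '[w, w] '[S h, S h] '[C h, C h] => a b s q.
  move=> h2 h3 h4 a0 b0 s0.
  have q1 : 1 <= c ^+ 2 by rewrite exprn_ege1.
  suff : c ^+ 2 * a <= (c ^+ 2 - 1) * b by lra.
  (* From a <= c^2 q and q = a - s. Multiplying the goal by a then reduces it to a^2 <= b s. *)
  have h5 : c ^+ 2 * s <= (c ^+ 2 - 1) * a by nra.
  move: a0; rewrite le_eqVlt => /predU1P[<-|a0]; first by rewrite mulr0 mulr_ge0//; lra.
  rewrite -(ler_pM2r a0) -mulrA -expr2.
  have h6 : c ^+ 2 * a ^+ 2 <= c ^+ 2 * (b * s) by rewrite ler_wpM2l//; lra.
  by apply: le_trans h6 _; nra.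
have below' w : N w <= c ^+ 2 * N (Z w).
  have := below w; have := rdot_le_norm (Z w) w; rewrite -rnorm2.
  have c2 : 0 < c ^+ 2 by rewrite exprn_gt0.
  have := rnorm_ge0 w; rewrite le_eqVlt => /predU1P[<-|w0] h1 h2.
    by rewrite mulr_ge0 ?rnorm_ge0// ltW.
  by rewrite -(ler_pM2r w0) -mulrA -expr2; nra.
have Z0 w : Z w = 0 -> w = 0.
  move=> e; apply: rnorm0_eq0; apply/eqP; rewrite eq_le rnorm_ge0 andbT.
  by have := below' w; rewrite e rnorm0 mulr0.
(* Z is symmetric and bounded below, so every functional (v, .) is dominated by |Z .|. *)
have Zs v : exists w, Z w = v.
  have [||||w [e _ _]] := @range_of_bound Z Z v (c ^+ 2 * N v) => //.
  - by rewrite mulr_ge0 ?rnorm_ge0 ?exprn_ge0// ltW.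
  - move=> y; apply: le_trans (rdot_le_norm _ _) _.
    by rewrite mulrC mulrAC; rewrite ler_wpM2r ?rnorm_ge0//; exact: below'.
  by exists w.
have [V hV] := choice Zs.
have lV : linear V.
  move=> a x y; apply/subr0_eq/Z0.
  by rewrite (linear_funB lZ) lZ !hV subrr.
have e : rel_of Y = rel_graph (Y \o V).
  apply/seteqP; split=> [_ [w ->]|[x y] /rel_graphP ->].
    apply/rel_graphP => /=; congr Y; apply/subr0_eq/Z0.
    by rewrite (linear_funB lZ) hV subrr.
  by exists (V x); congr pair; rewrite -/(Z _) hV.
have nY := rel_of_nnsa eY; rewrite e in nY *.
apply: (@Bplus_graph _ (c ^+ 2)) => // [|x]; first exact: linear_comp.
apply: le_trans (effect_norm _ eY) _; rewrite -{2}(hV x); exact: below'.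
Qed.

Lemma Bplus_short : Bplus dot (rel_of Y) <->
  closed_subspace (sqrt_preimage dot (rel_of X) L) /\ rel_mul (rel_of X) `&` L = [set 0].
Proof.
rewrite (sqrt_preimage_rel_of _ eX) closed_subspaceP; split.
  move=> B; split.
    split; first exact: (cs_image_subspace eX hL).
    exact: (closed_of_Bplus eX hL B).
  rewrite -(rel_mul_short eX hL); case: B => _ [T _ ->].
  apply/seteqP; split=> [y /rel_graphP ->|_ ->]; first exact: linear0.
  by apply/rel_graphP; rewrite linear0.
move=> [[_ clo] mul0]; apply: Bplus_of_closed => // h Mh Ch.
have Xh : X h = h by exact/(cs_eq0 eX).
suff : [set 0 : H] h by [].
rewrite -mul0 -(rel_mul_short eX hL); apply/rel_of_mulP/(short_fix eX hL).
split => //; have LS := Mh; rewrite /pre_short /= in LS.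
by rewrite -(sn_fix eX Xh).
Qed.
End BoundedShort.
End HilbertSpace.

Theorem theorem3p1 (R : realType) (H : completeNormedModType R[i])
    (dot : {dot H for @Num.conj R[i]})
    (normE : forall x : H, `|x| ^+ 2 = dot x x)
    (A : set (H * H)) (L : set H)
    (hA : nnsa_in dot setT A) (hL : closed_subspace L) :
  exists AL : set (H * H),
    [/\ unique (greatest_of dot (Xi dot A L)) AL,
        orth_compl dot L `<=` rel_ker AL
      & [/\ selfadjoint_in dot L (rel_restr AL L) /\
            associated_in dot L (rel_restr AL L)^-1%relation
              (rel_ran (rel_sqrt dot A) `&` L) (form_val dot A^-1%relation),
            rel_ran (rel_sqrt dot AL) = rel_ran (rel_sqrt dot A) `&` L /\
            (AL = rel_graph (fun=> 0) <-> rel_ran (rel_sqrt dot A) `&` L = [set 0]),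
            AL = cayley_contraction
                   (rel_sub (rel_graph idfun)
                      (shorted dot (rel_sub (rel_graph idfun) (cayley A)) L)),
            rel_mul AL = [set 0] <-> rel_mul A `&` L = [set 0]
          & Bplus dot AL /\ AL <> rel_graph (fun=> 0) <->
            [/\ closed_subspace (sqrt_preimage dot A L),
                rel_mul A `&` L = [set 0]
              & rel_ran (rel_sqrt dot A) `&` L <> [set 0]]]].
Proof.
have {}hL := (closed_subspaceP L).1 hL.
have [X eX ->] := nnsa_rel_of normE hA.
have eY := short_effect normE eX hL; have [lY _ _ _] := eY.
exists (rel_of (short dot X L)); rewrite !rel_ran_sqrt//.
split; first exact: greatest_Xi.
- move=> x hx; have Ox : orthog dot L x by move=> y /hx e; rewrite /rdot e.
  have Y0 := short_orthog normE eX hL Ox.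
  by exists x; rewrite Y0 subr0.
split.
- split; first by have [] := rel_restr_short_nnsa normE eX hL.
  exact: associated_short.
- by split; [exact: range_sn_short|exact: range_sn_short_eq0].
- by rewrite (rel_sub_cayley normE) shorted_graph// cayley_contraction_graph.
- by rewrite (rel_mul_short normE eX hL).
(* In (5), A_L <> 0 enters through (2) as a condition of its own: if ran A^{1/2} meets L only in 0,
   then the manifold is ker A, which is closed, and mul A meets L only in 0, while A_L = 0. *)
have [B1 B2] := Bplus_short normE eX hL; have [Z1 Z2] := range_sn_short_eq0 normE eX hL.
split=> [[/B1[cl mul0] nz]|[cl mul0 nz]]; first by split => // /Z2.
by split; [exact: B2|move=> /Z1].
Qed.
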